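(* Let an $n$-vertex IFS with probabilities on $\mathbb{R}^m$ be given, with contracting similarities $(S_e)_{e\in E^1}$ and attractor $(F_u)_{u\in V}$. Suppose that the OSC holds and that the non-negative $n\times n$ matrix $\mathbf{B}(q,\gamma,l)$ is irreducible. Let $u\in V$, $q\in\mathbb{R}$, and let $\gamma=\gamma(q)\in\mathbb{R}$ be the unique number such that $\rho(\mathbf{B}(q,\gamma,l))=1$. Let $r\in(0,\delta)$ and let $e,f\in E_u^1$ with $e\neq f$. Then $$Q_{e,f}^q(r)=M_u^q\left(S_e(F_{t(e)})\cap S_f(F_{t(f)})(r),\,r\right)\leq C_{e,f}\,r^{-\gamma(q)}$$ for some constant $C_{e,f}>0$ (depending on $q$ but not on $r$).
   Context: **Directed graph.** $V$ is a finite vertex set, $n=\#V$, and $E^1$ a finite set of directed edges; each $e\in E^1$ has an initial vertex $i(e)$ and a terminal vertex $t(e)$ (loops and multiple edges are allowed). The graph is strongly connected and each vertex has at least two edges leaving it. A path of length $k\ge1$ is $\mathbf{e}=e_1\cdots e_k$ with $t(e_j)=i(e_{j+1})$; $|\mathbf{e}|=k$, $i(\mathbf{e})=i(e_1)$, $t(\mathbf{e})=t(e_k)$. $E^k_u$ (resp. $E^k_{uv}$) is the set of paths of length $k$ starting at $u$ (resp. starting at $u$ and ending at $v$). **$n$-vertex IFS with probabilities on $\mathbb{R}^m$.** To each $e\in E^1$ is assigned a contracting similarity $S_e:\mathbb{R}^m\to\mathbb{R}^m$ with ratio $r_e\in(0,1)$ and a weight $p_e\in(0,1)$, such that $\sum_{e\in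 E^1_u}p_e=1$ for every $u\in V$. For a path, $S_{\mathbf{e}}=S_{e_1}\circ\cdots\circ S_{e_k}$, $r_{\mathbf{e}}=r_{e_1}\cdots r_{e_k}$, $p_{\mathbf{e}}=p_{e_1}\cdots p_{e_k}$. The attractor $(F_u)_{u\in V}$ is the unique list of non-empty compact subsets of $\mathbb{R}^m$ with $F_u=\bigcup_{e\in E^1_u}S_e(F_{t(e)})$ for all $u$. $(\mu_u)_{u\in V}$ is the unique list of Borel probability measures on $\mathbb{R}^m$ with $\mu_u(A)=\sum_{e\in E_u^1}p_e\,\mu_{t(e)}(S_e^{-1}(A))$ for all Borel $A$ and $u\in V$; one has $\operatorname{supp}\mu_u=F_u$. **Separation conditions.** OSC: there are non-empty bounded open sets $(U_u)_{u\in V}$ in $\mathbb{R}^m$ such that for each $u$, $S_e(U_{t(e)})\subset U_u$ for all $e\in E_u^1$ and $S_e(U_{t(e)})\cap S_f(U_{t(f)})=\emptyset$ for all $e\ne f$ in $E_u^1$. SOSC: the OSC holds with sets that also satisfy $F_u\cap U_u\neq\emptyset$ for all $u$ (for contracting similarities this is known to be equivalent to the OSC). **Packing moments.** $B(x,r)$ is the closed ball; $A(r)=\{x:\operatorname{dist}(x,A)\le r\}$ is the closed $r$-neighbourhood of $A$ (so $S_f(F_{t(f)})(r)$ is the closed $r$-neighbourhood of $S_f(F_{t(f)})$). For $r>0$, $D\subset A$ is an $r$-separated subset of $A$ if $|x-y|>2r$ for all distinct $x,y\in D$. For $q\in\mathbb{R}$, $r>0$, $A\subset F_u$, $$M_u^q(A,r)=\sup\Big\{\sum_{x\in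 D}\mu_u(B(x,r))^q: D\text{ is an }r\text{-separated subset of }A\Big\}.$$ **The matrix $\mathbf{B}(q,\gamma,l)$.** Fix open sets $(U_u)_{u\in V}$ satisfying the SOSC and paths $(\mathbf{l}_u)_{u\in V}$, all of the same length $l$, with $i(\mathbf{l}_u)=u$ and $S_{\mathbf{l}_u}(F_{t(\mathbf{l}_u)})\subset U_u$ for each $u\in V$ (such paths always exist, with $l$ as large as desired). $\mathbf{B}(q,\gamma,l)$ is the $n\times n$ matrix with $uv$th entry $\sum_{\mathbf{e}\in E_{uv}^l,\ \mathbf{e}\neq\mathbf{l}_u}p_{\mathbf{e}}^qr_{\mathbf{e}}^{\gamma}$ ($0$ if the index set is empty). A non-negative matrix $\mathbf{M}$ is irreducible if for all $i,j$ there is $k\in\mathbb{N}$ with $(\mathbf{M}^k)_{ij}>0$; $\rho$ denotes spectral radius. When $\mathbf{B}(q,\gamma,l)$ is irreducible, for each $q\in\mathbb{R}$ there is a unique $\gamma=\gamma(q)\in\mathbb{R}$ with $\rho(\mathbf{B}(q,\gamma,l))=1$. **The constant $\delta$.** $c_v=\operatorname{dist}(S_{\mathbf{l}_v}(F_{t(\mathbf{l}_v)}),\mathbb{R}^m\setminus U_v)>0$, $c_{\min}=\min_v c_v$, $r_{\min}=\min_{e\in E^1}r_e$, $r_{\max}=\max_{e\in E^1}r_e$, $d_{\min}=\min_v|F_v|$, $d_{\max}=\max_v|F_v|$, where $|F_v|$ is the diameter. Choose $N\in\mathbb{N}$ with $\frac{2d_{\max}}{c_{\min}}\le\frac{1}{r_{\max}^{N-1}}$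 and put $\delta=r_{\min}^{N+l+1}d_{\min}$; $l$ is assumed large enough that $0<\delta<1$. *)

(* Defs.v *)
From HB Require Import structures.
From mathcomp Require Import all_boot all_order all_algebra.
From mathcomp Require Import complex.
From mathcomp Require Import all_classical all_reals all_analysis.

Set Implicit Arguments.
Unset Strict Implicit.
Unset Printing Implicit Defensive.

Import Order.TTheory GRing.Theory Num.Theory.
Import numFieldNormedType.Exports.

Local Open Scope classical_set_scope.
Local Open Scope ring_scope.

Section Euclidean.
Context {R : realType} {m : nat}.
Implicit Types (x y : 'rV[R]_m) (A B : set 'rV[R]_m).

(* The library norm on 'rV[R]_m is the sup norm; its topology (used for open,
   compact and Borel sets) is the Euclidean one, but balls, diameters,
   distances and similarities need the Euclidean metric. *)
Definition eudist x y : R := Num.sqrt (\sum_(i < m) (x ord0 i - y ord0 i) ^+ 2).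

Definition euball x (r : R) : set 'rV[R]_m := [set y | eudist x y <= r].

Definition ebounded A : Prop :=
  exists M : R, forall x y, A x -> A y -> eudist x y <= M.

(* Real inf/sup are the infimum and supremum on the nonempty bounded sets
   to which the next three definitions are applied. *)
Definition diameter A : R := sup [set eudist x y | x in A & y in A].

Definition dist_pt x A : R := inf [set eudist x y | y in A].

Definition dist_set A B : R := inf [set eudist x y | x in A & y in B].

Definition closed_nbhd A (r : R) : set 'rV[R]_m := [set x | dist_pt x A <= r].

Definition separated_set (r : R) (D : set 'rV[R]_m) : Prop :=
  forall x y, D x -> D y -> x <> y -> 2 * r < eudist x y.

Definition contracting_similarity (S : 'rV[R]_m -> 'rV[R]_m) (c : R) : Prop :=
  0 < c < 1 /\ forall x y, eudist (S x) (S y) = c * eudist x y.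

End Euclidean.

Definition borel_rV (R : realType) (m : nat) :=
  g_sigma_algebraType (@open 'rV[R]_m).

Definition borel_probability (R : realType) (m : nat) :=
  probability (borel_rV R m) R.

Section Paths.
Variables (V E : finType) (ini ter : E -> V).

(* With u the initial vertex; the empty sequence counts as a path of length 0
   from u to u, so positivity of the length is required where it is used. *)
Fixpoint is_path (u : V) (s : seq E) : bool :=
  if s is e :: s' then (ini e == u) && is_path (ter e) s' else true.

Definition path_end (u : V) (s : seq E) : V := last u (map ter s).

End Paths.

Record digraph := Digraph {
  vertex : finType;
  edge : finType;
  ini : edge -> vertex;
  ter : edge -> vertex;
  strongly_connected : forall u v : vertex, exists s : seq edge,
    [/\ s <> [::], is_path ini ter u s & path_end ter u s = v];
  two_edges_out : forall u : vertex, (2 <= #|[set e | ini e == u]%SET|)%N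
}.

Arguments ini {d} e.
Arguments ter {d} e.

Record ifs_prob (R : realType) (m : nat) (G : digraph) := IfsProb {
  simil : edge G -> 'rV[R]_m -> 'rV[R]_m;
  ratio : edge G -> R;
  weight : edge G -> R;
  similP : forall e, contracting_similarity (simil e) (ratio e);
  weight_itv : forall e, 0 < weight e < 1;
  weight_sum1 : forall u, \sum_(e | ini e == u) weight e = 1
}.

Section IFS.
Context {R : realType} {m : nat} {G : digraph}.
Variable I : ifs_prob R m G.
Local Notation V := (vertex G).
Local Notation E := (edge G).
Implicit Types (F U : V -> set 'rV[R]_m) (mu : V -> borel_probability R m).

Definition path_simil (s : seq E) : 'rV[R]_m -> 'rV[R]_m :=
  foldr (fun e g => simil I e \o g) id s.

Definition path_ratio (s : seq E) : R := \prod_(e <- s) ratio I e.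

Definition path_weight (s : seq E) : R := \prod_(e <- s) weight I e.

Definition is_attractor F : Prop :=
  forall u, [/\ F u !=set0, compact (F u) &
    F u = \bigcup_(e in [set e | ini e = u]) (simil I e @` F (ter e))].

Definition is_selfsimilar_measure mu : Prop :=
  forall (u : V) (A : set (borel_rV R m)), measurable A ->
    mu u A = (\sum_(e : E | ini e == u)
                (weight I e)%:E * mu (ter e) (simil I e @^-1` A))%E.

Definition osc_sets U : Prop :=
  [/\ forall u, [/\ U u !=set0, ebounded (U u) & open (U u)],
      forall e, simil I e @` U (ter e) `<=` U (ini e) &
      forall e f, ini e = ini f -> e <> f ->
        (simil I e @` U (ter e)) `&` (simil I f @` U (ter f)) = set0].

Definition osc : Prop := exists U, osc_sets U.

Definition sosc_sets F U : Prop :=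
  osc_sets U /\ forall u, F u `&` U u !=set0.

(* esum is the unordered sum, so D ranges over arbitrary separated subsets
   (they are finite when A is bounded). *)
Definition packing_moment mu (u : V) (q : R) (A : set 'rV[R]_m) (r : R) :
    \bar R :=
  ereal_sup [set (\esum_(x in D) (mu u (euball x r) `^ q)%E)%R |
             D in [set D | D `<=` A /\ separated_set r D]].

Definition Qmoment F mu (u : V) (q : R) (e f : E) (r : R) : \bar R :=
  packing_moment mu u q
    ((simil I e @` F (ter e)) `&` closed_nbhd (simil I f @` F (ter f)) r) r.

Section Matrix.
Variables (l : nat) (lw : V -> l.-tuple E).

Definition admissible_words F U : Prop :=
  forall u, is_path ini ter u (lw u) /\
    path_simil (lw u) @` F (path_end ter u (lw u)) `<=` U u.

(* Rows and columns are indexed by V through its enumeration. *)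
Definition Bmatrix (q gamma : R) : 'M[R]_#|V| :=
  \matrix_(i < #|V|, j < #|V|)
    \sum_(s : l.-tuple E | [&& is_path ini ter (enum_val i) s,
                               path_end ter (enum_val i) s == enum_val j &
                               s != lw (enum_val i)])
      path_weight s `^ q * path_ratio s `^ gamma.

Definition c_gap F U (v : V) : R :=
  dist_set (path_simil (lw v) @` F (path_end ter v (lw v))) (~` U v).

Definition c_min F U : R := inf (range (c_gap F U)).

End Matrix.

(* inf and sup over a nonempty finite family are its min and max. *)
Definition r_min : R := inf (range (ratio I)).
Definition r_max : R := sup (range (ratio I)).
Definition d_min F : R := inf (range (fun v : V => diameter (F v))).
Definition d_max F : R := sup (range (fun v : V => diameter (F v))).

Definition delta (N l : nat) F : R := r_min ^+ (N + l + 1) * d_min F.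

End IFS.

Definition irreducible_mx (R : realType) (n : nat) (M : 'M[R]_n) : Prop :=
  (forall i j, 0 <= M i j) /\
  forall i j, exists k : nat, (0 < k)%N /\ 0 < (M ^+ k) i j.

Definition spectral_radius (R : realType) (n : nat) (M : 'M[R]_n) : R :=
  sup [set ComplexField.Normc.normc z |
       z in [set z : R[i] | eigenvalue (map_mx (real_complex R) M) z]].

(* Main.v *)
(* If [x] in [S_e(F)] lies within [r] of [S_f(F)], then every cell [S_w(F)] that
   meets [B(x,r)] starts with an edge [g] and comes within [3 r] of [S_h(F)] for
   some edge [h <> g].  Were one of the length-[l] blocks of [w] after [g] the
   special word [l_v], at a point where the contraction ratio so far is [rho], then
   the cell would have distance at least [rho * c] from [S_h(F)], because [S_h(U)]
   avoids [S_g(U)] and [F] lies in the closure of [U].  So no block of [w] is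
   special as long as [rho > 3 r / c], and it suffices to sum over the words cut at
   ratio about [3 r / c] without special blocks.  A Perron eigenvector [xi] of the
   matrix [B], whose eigenvalue is at most [rho(B) = 1], makes
   the sum of [p_w^q r_w^gamma xi(t(w))] non-increasing down the tree of these words,
   so the sum of [p_w^q] over them is [O(r^-gamma)].  Finally [mu(B(x,r))^q] is at most a
   constant times [p_w^q] for one of the cells meeting the ball, and a packing
   argument bounds the number of points charged to a cell. *)

Require Import Defs.
From HB Require Import structures.
From mathcomp Require Import all_boot all_order all_algebra.
From mathcomp Require Import complex.
From mathcomp Require Import all_classical all_reals all_analysis.
From mathcomp Require Import ring lra.

Set Implicit Arguments.
Unset Strict Implicit.
Unset Printing Implicit Defensive.

Import Order.TTheory GRing.Theory Num.Theory.
Import numFieldNormedType.Exports.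

Local Open Scope classical_set_scope.
Local Open Scope ring_scope.

(** * Euclidean geometry *)

Section FiniteBounds.
Context {R : realType} {T : finType}.

Lemma fin_ubound (f : T -> R) : exists2 M, 0 < M & forall x, f x <= M.
Proof.
exists (1 + \sum_x `|f x|).
  by rewrite ltr_pwDl// sumr_ge0.
move=> x; rewrite (bigD1 x)//= (le_trans (ler_norm _))//.
rewrite addrCA lerDl addr_ge0// sumr_ge0//.
Qed.

Lemma fin_lbound (f : T -> R) : (forall x, 0 < f x) ->
  exists2 c, 0 < c & forall x, c <= f x.
Proof.
move=> f0; have [M M0 MP] := fin_ubound (fun x => (f x)^-1).
exists M^-1; first by rewrite invr_gt0.
by move=> x; rewrite -[f x]invrK lef_pV2 ?posrE ?invr_gt0.
Qed.

End FiniteBounds.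

Section EuclideanMetric.
Context {R : realType} {m : nat}.
Implicit Types (x y z : 'rV[R]_m).

(** Lagrange's identity: the double sum of the squares of [a i * b j - a j * b i] is twice the
    difference of the two sides. *)
Lemma cauchy_schwarz_sum (a b : 'I_m -> R) :
  (\sum_i a i * b i) ^+ 2 <= (\sum_i a i ^+ 2) * (\sum_i b i ^+ 2).
Proof.
have : 0 <= \sum_i \sum_j (a i * b j - a j * b i) ^+ 2.
  by apply: sumr_ge0 => i _; apply: sumr_ge0 => j _; rewrite sqr_ge0.
have -> : \sum_i \sum_j (a i * b j - a j * b i) ^+ 2 =
    2 * ((\sum_i a i ^+ 2) * (\sum_i b i ^+ 2) - (\sum_i a i * b i) ^+ 2).
  have E i : \sum_j (a i * b j - a j * b i) ^+ 2 =
     a i ^+ 2 * (\sum_j b j ^+ 2) + b i ^+ 2 * (\sum_j a j ^+ 2)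
     - 2 * (a i * b i) * \sum_j a j * b j.
    rewrite !mulr_sumr -big_split/= -sumrB; apply: eq_bigr => j _; ring.
  rewrite (eq_bigr _ (fun i _ => E i)) sumrB big_split/= -!mulr_suml.
  rewrite -mulr_sumr; ring.
by rewrite pmulr_rge0// subr_ge0.
Qed.

Lemma sum_sqr_ge0 (a : 'I_m -> R) : 0 <= \sum_i a i ^+ 2.
Proof. by apply: sumr_ge0 => i _; rewrite sqr_ge0. Qed.

Lemma eudist_ge0 x y : 0 <= eudist x y. Proof. exact: sqrtr_ge0. Qed.

Lemma sqr_eudist x y :
  eudist x y ^+ 2 = \sum_i (x ord0 i - y ord0 i) ^+ 2.
Proof. by rewrite sqr_sqrtr// sum_sqr_ge0. Qed.

Lemma eudistxx x : eudist x x = 0.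
Proof.
by rewrite /eudist big1 ?sqrtr0// => i _; rewrite subrr expr0n.
Qed.

Lemma eudistC x y : eudist x y = eudist y x.
Proof.
by congr Num.sqrt; apply: eq_bigr => i _; rewrite -sqrrN opprB.
Qed.

Lemma eudist_triangle y x z : eudist x z <= eudist x y + eudist y z.
Proof.
rewrite -(@ler_pXn2r _ 2)// ?nnegrE ?addr_ge0 ?eudist_ge0//.
rewrite sqrrD !sqr_eudist.
have -> : \sum_i (x ord0 i - z ord0 i) ^+ 2 =
    \sum_i (x ord0 i - y ord0 i) ^+ 2 +
    (\sum_i (x ord0 i - y ord0 i) * (y ord0 i - z ord0 i)) *+ 2 +
    \sum_i (y ord0 i - z ord0 i) ^+ 2.
  rewrite -mulr_natl mulr_sumr -!big_split/=; apply: eq_bigr => i _; ring.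
rewrite lerD2r lerD2l lerMn2r/=.
rewrite (le_trans (ler_norm _))//.
rewrite -(@ler_pXn2r _ 2)// ?nnegrE ?mulr_ge0 ?eudist_ge0//.
by rewrite real_normK ?num_real// exprMn !sqr_eudist cauchy_schwarz_sum.
Qed.

Lemma coord_le_eudist x y i : `|x ord0 i - y ord0 i| <= eudist x y.
Proof.
rewrite -(@ler_pXn2r _ 2)// ?nnegrE ?eudist_ge0//.
rewrite real_normK ?num_real// sqr_eudist (bigD1 i)//= lerDl.
by apply: sumr_ge0 => j _; rewrite sqr_ge0.
Qed.

(** The factor [m.+1] in place of the square root of [m] avoids roots and keeps the inequality
    strict even for [m = 0]. *)
Lemma eudist_lt_coord x y (eta : R) : 0 < eta ->
  (forall i, `|x ord0 i - y ord0 i| < eta) -> eudist x y < m.+1%:R * eta.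
Proof.
move=> eta0 h.
rewrite -(@ltr_pXn2r _ 2)// ?nnegrE ?eudist_ge0 ?mulr_ge0// ?ltW//.
rewrite sqr_eudist exprMn.
apply: (@le_lt_trans _ _ (m%:R * eta ^+ 2)).
  have -> : m%:R * eta ^+ 2 = \sum_(i < m) eta ^+ 2.
    by rewrite sumr_const card_ord mulr_natl.
  apply: ler_sum => i _.
  by rewrite -real_normK ?num_real// lerXn2r ?nnegrE// ltW.
rewrite ltr_pM2r ?exprn_gt0//.
apply: (@lt_le_trans _ _ m.+1%:R); first by rewrite ltr_nat.
by rewrite expr2 ler_peMr// ler1n.
Qed.

Lemma eudist_eq0 x y : eudist x y = 0 -> x = y.
Proof.
move=> h; apply/rowP => i; apply/eqP; rewrite -subr_eq0 -normr_eq0.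
by rewrite eq_le normr_ge0 andbT -h coord_le_eudist.
Qed.

Lemma ball_eudist x (e : R) : 0 < e ->
  [set y | eudist x y < e] `<=` ball x e.
Proof.
move=> e0 y /= xy; split=> // i j; rewrite (ord1 i) -ball_normE /ball_/=.
exact: le_lt_trans (coord_le_eudist x y j) xy.
Qed.

Lemma eudist_ball x (e : R) : 0 < e ->
  ball x (e / m.+1%:R) `<=` [set y | eudist x y < e].
Proof.
move=> e0 y xy /=.
have -> : e = m.+1%:R * (e / m.+1%:R) by rewrite mulrC divfK// pnatr_eq0.
apply: eudist_lt_coord; first by rewrite divr_gt0// ltr0n.
by move=> i; have := xy.2 ord0 i; rewrite -ball_normE /ball_/=.
Qed.

(** Links the topology, which comes from the sup norm, to the Euclidean metric. *)
Lemma nbhs_eudistP x (A : set 'rV[R]_m) :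
  nbhs x A <-> exists2 e, 0 < e & [set y | eudist x y < e] `<=` A.
Proof.
split.
  move=> /nbhs_ballP[e/= e0 eA]; exists e => //.
  exact: subset_trans (ball_eudist e0) eA.
move=> [e e0 eA]; apply/nbhs_ballP; exists (e / m.+1%:R) => /=.
  by rewrite divr_gt0// ltr0n.
exact: subset_trans (eudist_ball e0) eA.
Qed.

Lemma open_eudistP (A : set 'rV[R]_m) :
  open A <-> forall x, A x ->
    exists2 e, 0 < e & [set y | eudist x y < e] `<=` A.
Proof.
rewrite openE; split => h x Ax; first by apply/nbhs_eudistP/h.
by apply/nbhs_eudistP/h.
Qed.

Lemma open_eudist_gt z (s : R) : open [set y | s < eudist y z].
Proof.
apply/open_eudistP => x /= sx; exists (eudist x z - s); first by rewrite subr_gt0.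
by move=> y /= xy; have := eudist_triangle y x z; lra.
Qed.

Lemma open_eudist_lt z (s : R) : open [set y | eudist y z < s].
Proof.
apply/open_eudistP => x /= sx; exists (s - eudist x z); first by rewrite subr_gt0.
by move=> y /= xy; have := eudist_triangle x y z; rewrite (eudistC y x); lra.
Qed.

Lemma closed_euball x (r : R) : closed (euball x r).
Proof.
rewrite -openC.
suff -> : ~` euball x r = [set y | r < eudist y x] by exact: open_eudist_gt.
by apply/seteqP; split => y /=; rewrite /euball/= eudistC ltNge => /negP.
Qed.

Lemma closed_far (A : set 'rV[R]_m) (s : R) :
  closed [set y | forall z, A z -> s <= eudist y z].
Proof.
have -> : [set y | forall z, A z -> s <= eudist y z] =
    \bigcap_(z in A) [set y | s <= eudist y z] by [].
apply: closed_bigI => z _; rewrite -openC.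
suff -> : ~` [set y | s <= eudist y z] = [set y | eudist y z < s].
  exact: open_eudist_lt.
by apply/seteqP; split => y /=; rewrite ltNge => /negP.
Qed.

Lemma compact_ebounded (A : set 'rV[R]_m) : compact A -> ebounded A.
Proof.
move=> /compact_bounded [M [_ MA]].
exists (m.+1%:R * (2 * (`|M| + 1) + 1)) => x y Ax Ay.
have M1 : M < `|M| + 1 by rewrite (le_lt_trans (ler_norm _))// ltrDl.
have H z : A z -> forall i, `|z ord0 i| <= `|M| + 1.
  move=> Az i; apply: le_trans (MA _ M1 z Az).
  by rewrite /Num.norm/= mx_normrE (le_trans _ (le_bigmax _ _ (ord0, i))).
apply/ltW/eudist_lt_coord; first by have := normr_ge0 M; lra.
move=> i; rewrite (le_lt_trans (ler_normB _ _))//.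
by have := H x Ax i; have := H y Ay i; lra.
Qed.

(** Applied to a special cell inside [U v], this yields its positive gap to the complement. *)
Lemma compact_sub_open (K U : set 'rV[R]_m) : compact K -> open U ->
  K `<=` U ->
  exists2 c, 0 < c & forall x y, K x -> eudist x y < c -> U y.
Proof.
move=> /compact_near_coveringP cK oU KU.
pose P (c : R) x := forall y, eudist x y < c -> U y.
have : \forall c \near (0:R)^'+, K `<=` P c.
  apply: cK => x /KU Ux.
  have /open_eudistP/(_ _ Ux)[e e0 eU] := oU.
  (* Half of the radius is left for moving the centre, half for the distance [c]. *)
  exists ([set y | eudist x y < e / 2], [set c | c < e / 2]) => /=.
    split; first by apply/nbhs_eudistP; exists (e / 2) => //; lra.
    by apply: nbhs_right_lt; lra.
  move=> [y c] /= [xy ce] z yz; apply: eU => /=.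
  by have := eudist_triangle y x z; lra.
move=> H; near (0:R)^'+ => c.
exists c => // x y Kx xy; suff : P c x by apply.
by move: x Kx {xy}; near: c.
Unshelve. all: by end_near.
Qed.

End EuclideanMetric.

Section Similarities.
Context {R : realType} {m : nat}.
Implicit Types (x y z : 'rV[R]_m).

(* A similarity fixing the origin preserves the scalar product up to a factor,
   so it is given by a multiple of an orthogonal matrix. *)
Lemma similarity_surj (S : 'rV[R]_m -> 'rV[R]_m) (c : R) : 0 < c ->
  (forall x y, eudist (S x) (S y) = c * eudist x y) ->
  forall y, exists x, S x = y.
Proof.
move=> c0 hS.
have cn0 : c != 0 by rewrite gt_eqF.
(* [T] is the isometry fixing the origin that [S] induces; by polarization it preserves [dot]. *)
pose T x := c^-1 *: (S x - S 0).
pose dot x y := \sum_i x ord0 i * y ord0 i.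
have dotE x y : 2 * dot x y = eudist x 0 ^+ 2 + eudist y 0 ^+ 2 - eudist x y ^+ 2.
  rewrite !sqr_eudist -big_split/= -sumrB mulr_sumr.
  by apply: eq_bigr => i _; rewrite !mxE; ring.
have T0 : T 0 = 0 by rewrite /T subrr scaler0.
have distT x y : eudist (T x) (T y) = eudist x y.
  apply/eqP; rewrite -(@eqrXn2 _ 2)// ?eudist_ge0// -(inj_eq (mulfI (expf_neq0 2 cn0))).
  rewrite -[X in _ == X]exprMn -hS !sqr_eudist mulr_sumr; apply/eqP.
  by apply: eq_bigr => i _; rewrite !mxE; field.
have dotT x y : dot (T x) (T y) = dot x y.
  apply: (@mulfI _ 2); first by rewrite pnatr_eq0.
  by rewrite !dotE -{1 2}T0 !distT.
pose M := \matrix_(i < m) T (delta_mx ord0 i).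
(* A coordinate of [x] is its product with a basis vector, which [T] preserves; so multiplication by
   [M^T] undoes [T]. *)
have mulM x : T x *m M^T = x.
  apply/rowP => i; rewrite mxE.
  have -> : \sum_j T x ord0 j * M^T j i = dot (T x) (T (delta_mx ord0 i)).
    by apply: eq_bigr => j _; rewrite [M^T _ _]mxE [M _ _]mxE.
  rewrite dotT /dot (bigD1 i)//= big1 ?addr0.
    by rewrite mxE !eqxx mulr1.
  by move=> j ji; rewrite mxE (negbTE ji) andbF mulr0.
have MM : M *m M^T = 1%:M.
  apply/row_matrixP => i; rewrite row_mul rowK mulM.
  by rewrite rowE mulmx1.
(* For square matrices a one-sided inverse is two-sided, so [T] is multiplication by the invertible
   matrix [M], hence onto. *)
have TE x : T x = x *m M.
  by rewrite -{2}[x]mulM -mulmxA (mulmx1C MM) mulmx1.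
move=> y; exists (c^-1 *: (y - S 0) *m M^T).
set x := _ *m M^T.
have : T x = c^-1 *: (y - S 0) by rewrite TE -mulmxA (mulmx1C MM) mulmx1.
by move=> /(scalerI (invr_neq0 cn0))/addIr.
Qed.

(* Points are sent to the cells of a grid of mesh [rho * a / (m + 1)], which
   separated points cannot share. *)
Lemma packing_bound (A a : R) : 0 < A -> 0 < a ->
  exists K : nat, forall (rho : R) (x : 'rV[R]_m) (T : eqType) (s : seq T)
    (f : T -> 'rV[R]_m), 0 < rho -> uniq s ->
    {in s, forall i, eudist x (f i) <= rho * A} ->
    {in s &, forall i j, i != j -> rho * a <= eudist (f i) (f j)} ->
    (size s <= K)%N.
Proof.
move=> A0 a0.
have m0 : (0 : R) < m.+1%:R by rewrite ltr0n.
pose eta := a / m.+1%:R.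
have eta0 : 0 < eta by rewrite divr_gt0.
(* Each coordinate ranges over an interval of length [2 * rho * A]; measured in meshes [rho * eta]
   this no longer depends on [rho]. *)
pose M := Num.truncn (2 * A / eta).
exists #|{ffun 'I_m -> 'I_M.+1}| => rho x T s f rho0 us fA fa.
pose g i : {ffun 'I_m -> 'I_M.+1} :=
  [ffun k => inord (Num.truncn ((f i ord0 k - x ord0 k + rho * A) / (rho * eta)))].
have re0 : 0 < rho * eta by rewrite mulr_gt0.
have ginj : {in s &, injective g}.
  move=> i j si sj gij; apply/eqP/negP => /negP ij.
  have := fa i j si sj ij; apply/negP; rewrite -ltNge.
  have -> : rho * a = m.+1%:R * (rho * eta).
    by rewrite /eta; field; rewrite gt_eqF.
  apply: eudist_lt_coord => // k.
  have H i' : i' \in s ->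
     let v := (f i' ord0 k - x ord0 k + rho * A) / (rho * eta) in
     0 <= v <= 2 * A / eta.
    move=> si'; have := le_trans (coord_le_eudist x (f i') k) (fA _ si').
    rewrite distrC ler_norml => /andP[h1 h2]; apply/andP; split.
      by apply: divr_ge0 => //; [lra | exact: ltW].
    rewrite ler_pdivrMr//.
    have -> : 2 * A / eta * (rho * eta) = 2 * (rho * A).
      by field; rewrite gt_eqF.
    lra.
  have tr i' : i' \in s ->
      (Num.truncn ((f i' ord0 k - x ord0 k + rho * A) / (rho * eta)) < M.+1)%N.
    move=> /H /andP[h0 h1]; rewrite ltnS; exact: le_truncn.
  have /(congr1 val) := congr1 (fun h : {ffun _} => h k) gij.
  rewrite !ffunE /= !inordK ?tr// => E.
  have /andP[vi0 _] := H i si; have /andP[vj0 _] := H j sj.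
  have /andP[i1 i2] := truncn_itv vi0; have /andP[j1 j2] := truncn_itv vj0.
  (* Equal integer parts put [v] and [w] less than 1 apart, so the coordinates differ by less than
     one mesh. *)
  rewrite -E in j1 j2; set v := _ / _ in vi0 i1 i2; set w := _ / _ in vj0 j1 j2.
  have -> : f i ord0 k - f j ord0 k = (v - w) * (rho * eta).
    by rewrite /v /w; field; rewrite !gt_eqF.
  rewrite normrM (gtr0_norm re0) gtr_pMl// ltr_norml.
  set n := Num.truncn v in i1 i2 j1 j2.
  by move: i2 j2; rewrite -natr1; lra.
rewrite -(size_map g) -(card_uniqP _) ?map_inj_in_uniq//.
exact: max_card.
Qed.

End Similarities.

(** * Perron-Frobenius *)

Section NonnegativeMatrices.
Context {R : realType} {n : nat}.
Implicit Types M : 'M[R]_n.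

Definition nonneg_mx M := forall i j, 0 <= M i j.

Lemma nonneg_mxX M k : nonneg_mx M -> nonneg_mx (M ^+ k).
Proof.
move=> M0; elim: k => [|k IH] i j.
  by rewrite expr0 mxE ler0n.
by rewrite exprS mxE sumr_ge0// => a _; rewrite mulr_ge0.
Qed.

(** For each pair of indices take a power of [M] with that entry positive; the sum of these powers
    is positive and commutes with [M]. *)
Lemma irreducible_pos_comm M : irreducible_mx M ->
  exists P : 'M[R]_n, (forall i j, 0 < P i j) /\ P * M = M * P.
Proof.
move=> [M0 Mk].
pose k i j := sval (cid (Mk i j)).
exists (\sum_i \sum_j M ^+ k i j); split.
  move=> i j; rewrite summxE (bigD1 i)//= ltr_wpDr//.
    rewrite sumr_ge0// => a _; rewrite summxE sumr_ge0// => b _.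
    exact: nonneg_mxX.
  rewrite summxE (bigD1 j)//= ltr_wpDr//.
    by rewrite sumr_ge0// => b _; exact: nonneg_mxX.
  by rewrite /k; case: cid => /= a [].
rewrite mulr_suml mulr_sumr; apply: eq_bigr => i _.
rewrite mulr_suml mulr_sumr; apply: eq_bigr => j _.
by rewrite -exprSr -exprS.
Qed.

Lemma pos_mulmx_col (P : 'M[R]_n) (x : 'cV[R]_n) : (forall i j, 0 < P i j) ->
  (forall i, 0 <= x i 0) -> x != 0 -> forall i, 0 < (P *m x) i 0.
Proof.
move=> P0 x0 xn i; rewrite mxE.
have /existsP[j xj] : [exists j, x j 0 != 0].
  apply: contraNT xn; rewrite negb_exists => /forallP h.
  by apply/eqP/colP => j; rewrite mxE; have := h j; rewrite negbK => /eqP.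
rewrite (bigD1 j)//= ltr_wpDr//.
  by rewrite sumr_ge0// => a _; rewrite mulr_ge0// ltW.
by rewrite mulr_gt0// lt_def xj x0.
Qed.

End NonnegativeMatrices.

(* Maximality of the Collatz-Wielandt bound [lam] among the subinvariant vectors
   of the simplex. *)
Lemma collatz_wielandt_max {R : realType} {n : nat} (M : 'M[R]_n) : (0 < n)%N -> nonneg_mx M ->
  exists lam (x : 'cV[R]_n), [/\ forall i, 0 <= x i 0, x != 0,
    forall i, lam * x i 0 <= (M *m x) i 0 &
    forall mu (y : 'cV[R]_n), (forall i, 0 <= y i 0) -> y != 0 ->
      (forall i, mu * y i 0 <= (M *m y) i 0) -> mu <= lam].
Proof.
case: n M => // n' M _ M0.
(* Summing the subinvariance inequalities over the simplex shows that no bound exceeds the sum of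
   all entries. *)
pose L := \sum_i \sum_j M i j.
have L0 : 0 <= L by rewrite sumr_ge0// => i _; rewrite sumr_ge0.
pose A : set (R * 'rV[R]_n'.+1) :=
  [set p : R * 'rV[R]_n'.+1 | [/\ 0 <= p.1 <= L, forall i, 0 <= p.2 0 i <= 1,
     \sum_i p.2 0 i = 1 &
     forall i, 0 <= \sum_j M i j * p.2 0 j - p.1 * p.2 0 i]].
have coordC (i : 'I_n'.+1) : continuous (fun p : R * 'rV[R]_n'.+1 => p.2 0 i).
  move=> p; apply: (@continuous_comp _ _ _ snd (fun v : 'rV[R]_n'.+1 => v 0 i)).
    exact: cvg_snd.
  exact: coord_continuous.
have cA : compact A.
  have cB : compact (`[0, L]%classic `*`
      [set v : 'rV[R]_n'.+1 | forall i, `[0, 1]%classic (v ord0 i)]).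
    apply: compact_setX; first exact: segment_compact.
    have := @rV_compact R n'.+1 (fun=> `[0, 1]%classic) (fun=> @segment_compact R 0 1).
    by apply.
  apply: subclosed_compact cB _.
  - pose T := (R * 'rV[R]_n'.+1)%type.
    have -> : A = [set p : T | 0 <= p.1] `&` [set p : T | p.1 <= L] `&`
      (\bigcap_i ([set p : T | 0 <= p.2 0 i] `&` [set p : T | p.2 0 i <= 1])) `&`
      [set p : T | \sum_i p.2 0 i = 1] `&`
      \bigcap_i [set p : T | 0 <= \sum_j M i j * p.2 0 j - p.1 * p.2 0 i].
      apply/seteqP; split=> p.
        move=> [/andP[? ?] h2 ? h4]; split; last by move=> i _; exact: h4.
        split => //; split => // i _.
        by have /andP[? ?] := h2 i; split.
      move=> [[[[h1 h2] h3] h4] h5]; split => //.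
      + exact/andP.
      + by move=> i; have [? ?] := h3 i I; exact/andP.
      + by move=> i; exact: h5.
    have cfst : continuous (fst : R * 'rV[R]_n'.+1 -> R).
      by move=> p; exact: cvg_fst.
    have ge0c (g : R * 'rV[R]_n'.+1 -> R) c : continuous g ->
        closed [set p | c <= g p].
      by move=> /continuous_closedP/(_ _ (@closed_ge _ c)).
    have le0c (g : R * 'rV[R]_n'.+1 -> R) c : continuous g ->
        closed [set p | g p <= c].
      by move=> /continuous_closedP/(_ _ (@closed_le _ c)).
    have eq0c (g : R * 'rV[R]_n'.+1 -> R) c : continuous g ->
        closed [set p | g p = c].
      by move=> /continuous_closedP/(_ _ (@closed_eq _ c)).
    apply: closedI; [apply: closedI; [apply: closedI; [apply: closedI|]|]|].
    + exact: ge0c.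
    + exact: le0c.
    + by apply: closed_bigI => i _; apply: closedI; [exact: ge0c|exact: le0c].
    + by apply: eq0c; apply: continuous_big => //; exact: add_continuous.
    + apply: closed_bigI => i _; apply: ge0c => p.
      have sumC : continuous (fun p : T => \sum_j M i j * p.2 0 j).
        apply: continuous_big => [|j _ q]; first exact: add_continuous.
        by apply: cvgM; [exact: cvg_cst|exact: coordC].
      by apply: cvgB; [exact: sumC|apply: cvgM; [exact: cfst|exact: coordC]].
  - move=> p [h1 h2 _ _]; split => /=; first by rewrite in_itv.
    by move=> i; rewrite in_itv/= h2.
have A0 : A !=set0.
  exists (0, delta_mx 0 0); split => /=.
  - by rewrite lexx L0.
  - by move=> i; rewrite mxE eqxx; case: eqP; rewrite ?lexx ?ler01.
  - rewrite (bigD1 0)//= big1 ?mxE ?eqxx ?addr0//.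
    by move=> i i0; rewrite mxE (negbTE i0).
  - move=> i; rewrite mul0r subr0 sumr_ge0// => j _.
    by rewrite mulr_ge0// mxE ler0n.
have [|p Ap pmax] := @compact_EVT_max _ R fst A A0 cA.
  by apply: continuous_subspaceT => q; exact: cvg_fst.
move: Ap; rewrite inE => -[/andP[p0 _] p2 p1 pM].
have norm1 (y : 'cV[R]_n'.+1) : (forall i, 0 <= y i 0) -> y != 0 ->
    0 < \sum_i y i 0.
  move=> y0 yn; rewrite lt_def sumr_ge0 ?andbT//.
  apply: contraNneq yn => /eqP; rewrite psumr_eq0// => /allP h.
  by apply/eqP/colP => i; rewrite mxE; apply/eqP/h; rewrite mem_index_enum.
exists p.1, p.2^T; split.
- by move=> i; rewrite mxE; have /andP[] := p2 i.
- apply: contra_eq_neq p1 => h.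
  rewrite big1 1?eq_sym ?oner_neq0// => i _.
  by have := congr1 (fun v : 'cV[R]_n'.+1 => v i 0) h; rewrite [LHS]mxE [RHS]mxE.
- move=> i; rewrite !mxE -subr_ge0.
  under eq_bigr do rewrite mxE.
  exact: pM.
move=> mu y y0 yn ymu.
have [mu0|mu0] := ltP mu 0; first exact/ltW/(lt_le_trans mu0).
(* Subinvariance is homogeneous in [y], so [y] may be scaled onto the simplex. *)
have S0 := norm1 y y0 yn; set S := \sum_i _ in S0.
pose z i := y i 0 / S.
have z0 i : 0 <= z i by rewrite divr_ge0// ltW.
have z1 : \sum_i z i = 1 by rewrite -mulr_suml mulfV// gt_eqF.
have zle i : z i <= 1.
  by rewrite -z1 (bigD1 i)//= lerDl sumr_ge0.
have zmu i : mu * z i <= \sum_j M i j * z j.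
  have := ymu i; rewrite mxE => h.
  under eq_bigr do rewrite /z mulrA.
  by rewrite -mulr_suml /z mulrA ler_pM2r ?invr_gt0.
have := pmax (mu, \row_i z i); rewrite inE; apply; split => /=.
- rewrite mu0/= -[mu]mulr1 -z1 mulr_sumr; apply: ler_sum => i _.
  apply: le_trans (zmu i) _; apply: ler_sum => j _.
  by rewrite ler_piMr.
- by move=> i; rewrite mxE z0 zle.
- by under eq_bigr do rewrite mxE.
- move=> i; rewrite mxE subr_ge0.
  by under [leRHS]eq_bigr do rewrite mxE.
Qed.

Section PerronFrobenius.
Context {R : realType} {n : nat}.
Implicit Types M : 'M[R]_n.

(** If the maximal vector [x] were not an eigenvector, the positive matrix [P] would make the defect
    [M *m x - lam *: x] strictly positive, and [lam] could be increased for [P *m x]. *)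
Lemma perron_frobenius M : (0 < n)%N -> irreducible_mx M ->
  exists lam (h : 'cV[R]_n), [/\ 0 <= lam, forall i, 0 < h i 0 &
    M *m h = lam *: h].
Proof.
move=> n0 irrM; have M0 : nonneg_mx M by case: irrM.
have [P [P0 PM]] := irreducible_pos_comm irrM.
have [lam [x [x0 xn xlam lmax]]] := collatz_wielandt_max n0 M0.
have lam0 : 0 <= lam.
  apply: (lmax 0 x) => // i; rewrite mul0r mxE sumr_ge0// => j _.
  by rewrite mulr_ge0.
have PxM : M *m (P *m x) = P *m (M *m x) by rewrite !mulmxA -[M *m P]PM.
have Px0 := pos_mulmx_col P0 x0 xn.
exists lam, (P *m x); split => //.
pose w := M *m x - lam *: x.
have w0 i : 0 <= w i 0.
  by rewrite /w mxE [X in _ + X]mxE [X in _ - X]mxE subr_ge0.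
suff w_eq0 : w = 0.
  by apply/eqP; rewrite PxM scalemxAr -subr_eq0 -mulmxBr -/w w_eq0 mulmx0.
apply/eqP/negP => /negP wn.
have Pw0 := pos_mulmx_col P0 w0 wn.
(* A lower bound [eps] of these ratios is the amount by which [lam] can be increased. *)
pose c i := (P *m w) i 0 / (P *m x) i 0.
have [|eps eps0 epsP] := @fin_lbound _ _ c; first by move=> i; rewrite divr_gt0.
have : lam + eps <= lam.
  apply: (lmax _ (P *m x)).
  - by move=> i; exact: ltW.
  - apply/eqP => h; have := Px0 (Ordinal n0); rewrite h mxE ltxx//.
  - move=> i; have := epsP i; rewrite ler_pdivlMr// => hi.
    rewrite PxM mulrDl -lerBrDl (le_trans hi)//.
    by rewrite mulmxBr -scalemxAr [leLHS]mxE [X in _ + X]mxE [X in - X]mxE mxE.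
by apply/negP; rewrite -ltNge ltrDl.
Qed.

Lemma spectral_radius_ge M (lam : R) (h : 'cV[R]_n) : 0 <= lam ->
  h != 0 -> M *m h = lam *: h -> lam <= spectral_radius M.
Proof.
move=> lam0 hn Mh.
(* [eigenvalue] refers to row vectors while [h] is a column, so the eigenvalue is read off the
   transpose. *)
have charT : char_poly M^T = char_poly M.
  rewrite /char_poly -det_tr; congr (\det _).
  by apply/matrixP => i j; rewrite !mxE eq_sym.
have rootM : root (char_poly M) lam.
  rewrite -charT -eigenvalue_root_char; apply/eigenvalueP; exists h^T.
    by rewrite -trmx_mul Mh; apply/matrixP => i j; rewrite !mxE.
  by rewrite -(inj_eq (@trmx_inj _ _ _)) trmxK trmx0.
apply: ub_le_sup; last first.
  exists (real_complex R lam) => /=; last by rewrite expr0n addr0 sqrtr_sqr ger0_norm.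
  by rewrite eigenvalue_root_char -map_char_poly rmorph_root.
set p := char_poly (map_mx (real_complex R) M).
have [s ps] := closed_field_poly_normal p.
(* [sup] dominates its elements only on a set bounded above; the sum of the moduli of all roots is
   such a bound. *)
exists (\sum_(z <- s) ComplexField.Normc.normc z) => _ [z ez <-].
have zs : z \in s.
  have : root p z by rewrite -eigenvalue_root_char.
  rewrite ps rootZ ?root_prod_XsubC//.
  by rewrite lead_coef_eq0 monic_neq0// char_poly_monic.
rewrite (big_rem z)//= lerDl.
by rewrite sumr_ge0// => -[a b] _; exact: sqrtr_ge0.
Qed.

End PerronFrobenius.

(** * Words, attractor and self-similar measure *)

Section IFS.
Context {R : realType} {m : nat} {G : digraph} (I : ifs_prob R m G).
Local Notation V := (vertex G).
Local Notation E := (edge G).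
Local Notation ratio := Defs.ratio.
Local Notation is_path := (is_path (@ini G) (@ter G)).
Local Notation path_end := (path_end (@ter G)).
Implicit Types (v : V) (w : seq E).

Lemma is_path_cat v a b : is_path v (a ++ b) = is_path v a && is_path (path_end v a) b.
Proof. by elim: a v => //= e a IH v; rewrite IH andbA. Qed.

Lemma path_end_cat v a b : path_end v (a ++ b) = path_end (path_end v a) b.
Proof. by rewrite /path_end map_cat last_cat. Qed.

Lemma path_simil_cat a b x :
  path_simil I (a ++ b) x = path_simil I a (path_simil I b x).
Proof. by elim: a => //= e a IH; rewrite IH. Qed.

Lemma path_ratio_cat a b :
  path_ratio I (a ++ b) = path_ratio I a * path_ratio I b.
Proof. by rewrite /path_ratio big_cat. Qed.

Lemma path_weight_cat a b :
  path_weight I (a ++ b) = path_weight I a * path_weight I b.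
Proof. by rewrite /path_weight big_cat. Qed.

Lemma ratio_gt0 e : 0 < ratio I e.
Proof. by have [/andP[]] := similP I e. Qed.

Lemma weight_gt0 e : 0 < weight I e.
Proof. by have /andP[] := weight_itv I e. Qed.

Lemma path_ratio_gt0 w : 0 < path_ratio I w.
Proof. by rewrite /path_ratio; apply: prodr_gt0 => e _; exact: ratio_gt0. Qed.

Lemma path_weight_gt0 w : 0 < path_weight I w.
Proof. by rewrite /path_weight; apply: prodr_gt0 => e _; exact: weight_gt0. Qed.

Lemma path_ratio_ge c w : 0 < c -> (forall e, c <= ratio I e) ->
  c ^+ size w <= path_ratio I w.
Proof.
move=> c0 hc; elim: w => [|e w IH]; first by rewrite /path_ratio big_nil.
rewrite /path_ratio big_cons exprS; have c0' := ltW c0.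
by apply: ler_pM => //; exact: exprn_ge0.
Qed.

Lemma path_ratio_le c w : (forall e, ratio I e <= c) ->
  path_ratio I w <= c ^+ size w.
Proof.
move=> hc; elim: w => [|e w IH]; first by rewrite /path_ratio big_nil.
rewrite /path_ratio big_cons exprS ler_pM//; apply/ltW; first exact: ratio_gt0.
exact: path_ratio_gt0.
Qed.

Lemma path_weight_ge c w : 0 < c -> (forall e, c <= weight I e) ->
  c ^+ size w <= path_weight I w.
Proof.
move=> c0 hc; elim: w => [|e w IH]; first by rewrite /path_weight big_nil.
rewrite /path_weight big_cons exprS; have c0' := ltW c0.
by apply: ler_pM => //; exact: exprn_ge0.
Qed.

Lemma ratio_ubound_lt1 : exists2 c, 0 < c < 1 & forall e, ratio I e <= c.
Proof.
have [e|c c0 hc] := @fin_lbound R E (fun e => 1 - ratio I e).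
  by rewrite subr_gt0; have [/andP[]] := similP I e.
(* Capping at 1/2 keeps the final bound positive. *)
have c1 : 0 < Num.min c (1 / 2) by rewrite lt_min c0; lra.
have cle : Num.min c (1 / 2) <= 1 / 2 by rewrite ge_min lexx orbT.
exists (1 - Num.min c (1 / 2)).
  by apply/andP; split; lra.
move=> e; have : Num.min c (1 / 2) <= c by rewrite ge_min lexx.
by have := hc e; lra.
Qed.

Lemma eudist_path_simil w x y :
  eudist (path_simil I w x) (path_simil I w y) = path_ratio I w * eudist x y.
Proof.
elim: w => [|e w IH]; first by rewrite /path_ratio big_nil mul1r.
by rewrite /path_ratio big_cons/= (similP I e).2 IH mulrA.
Qed.

Lemma path_simil_inj w : injective (path_simil I w).
Proof.
move=> x y h; apply: eudist_eq0; have := eudist_path_simil w x y.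
rewrite h eudistxx => /esym/eqP; rewrite mulf_eq0 gt_eqF ?path_ratio_gt0//=.
by move/eqP.
Qed.

Lemma path_simil_surj w y : exists x, path_simil I w x = y.
Proof.
by apply: (similarity_surj (path_ratio_gt0 w)); exact: eudist_path_simil.
Qed.

(** Stated for a general family [X] because it serves both the attractor and the open sets. *)
Lemma path_simil_sub (X : V -> set 'rV[R]_m) v w x :
  (forall e, simil I e @` X (ter e) `<=` X (ini e)) ->
  is_path v w -> X (path_end v w) x -> X v (path_simil I w x).
Proof.
move=> hX; elim: w v => //= e w IH v /andP[/eqP <- pw] Xx.
by apply: hX; exists (path_simil I w x) => //; exact: IH.
Qed.

Lemma measurable_path_simil w (A : set (borel_rV R m)) : measurable A ->
  measurable (path_simil I w @^-1` A : set (borel_rV R m)).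
Proof.
move=> mA.
suff mf : measurable_fun setT (path_simil I w : borel_rV R m -> borel_rV R m).
  by rewrite -[X in measurable X]setTI; exact: mf.
apply: (@measurability _ _ (borel_rV R m) (borel_rV R m) setT (path_simil I w)
  (@open 'rV[R]_m)) => // _ [B oB <-].
apply: sub_sigma_algebra; rewrite setTI.
apply/open_eudistP => x /= Bx; have /open_eudistP/(_ _ Bx)[e e0 eB] := oB.
have r0 := path_ratio_gt0 w.
exists (e / path_ratio I w); first by rewrite divr_gt0.
move=> y /= xy; apply: eB => /=; rewrite eudist_path_simil.
by rewrite mulrC -ltr_pdivlMr.
Qed.

Section Attractor.
Context (F : V -> set 'rV[R]_m) (hF : is_attractor I F).

Lemma attractor_sub e : simil I e @` F (ter e) `<=` F (ini e).
Proof.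
have [_ _ ->] := hF (ini e) => x Fx; exists e => //.
Qed.

Lemma attractor_edge v x : F v x ->
  exists e y, [/\ ini e = v, F (ter e) y & x = simil I e y].
Proof.
have [_ _ ->] := hF v => -[e /= ev [y Fy <-]]; exists e, y; split=> //.
Qed.

Lemma attractor_closed v : closed (F v).
Proof. by apply: compact_closed; [exact: norm_hausdorff|have [] := hF v]. Qed.

Lemma attractor_word v x k : F v x -> exists w y,
  [/\ size w = k, is_path v w, F (path_end v w) y & x = path_simil I w y].
Proof.
elim: k v x => [|k IH] v x Fx; first by exists [::], x.
have [e [y [ev Fy ->]]] := attractor_edge Fx.
have [w [z [sw pw Fz ->]]] := IH _ _ Fy.
by exists (e :: w), z; split=> //=; rewrite ?sw// ev eqxx.
Qed.

(** Write [y] as the image of an attractor point under a long word; the same word sends a fixed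
    point of [U] into [U v], and contraction makes the two images close. *)
Lemma attractor_closure (U : V -> set 'rV[R]_m) v y (eta : R) :
  (forall v, U v !=set0) -> (forall e, simil I e @` U (ter e) `<=` U (ini e)) ->
  F v y -> 0 < eta -> exists2 z, U v z & eudist y z < eta.
Proof.
move=> U0 US Fy eta0.
pose a v := sval (cid (U0 v)); have Ua v' : U v' (a v') by rewrite /a; case: cid.
have bd v' : exists D, forall x, F v' x -> eudist x (a v') <= D.
  have [x0 Fx0] : F v' !=set0 by have [] := hF v'.
  have [_ /compact_ebounded[D hD] _] := hF v'.
  exists (D + eudist x0 (a v')) => x Fx.
  by apply: le_trans (eudist_triangle x0 _ _) _; rewrite lerD2r hD.
pose D v' := sval (cid (bd v')).
have hD v' x : F v' x -> eudist x (a v') <= D v' by rewrite /D; case: cid => ? /=; apply.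
have [M M0 DM] := fin_ubound D.
have [c /andP[c0 c1] hc] := ratio_ubound_lt1.
have [k hk] : exists k, c ^+ k < eta / M.
  have := @cvg_expr R c _; rewrite ger0_norm ?ltW// => /(_ c1)/cvgr0Pnorm_lt.
  move=> /(_ (eta / M) (divr_gt0 eta0 M0)) [k _ /(_ k (leqnn k))] /=.
  by rewrite ger0_norm ?exprn_ge0 ?ltW// => hk; exists k.
have [w [z [sw pw Fz ->]]] := attractor_word k Fy.
exists (path_simil I w (a (path_end v w))); first exact: path_simil_sub.
rewrite eudist_path_simil.
apply: (@le_lt_trans _ _ (c ^+ k * M)); last by rewrite -ltr_pdivlMr.
apply: ler_pM.
- exact/ltW/path_ratio_gt0.
- exact: eudist_ge0.
- by rewrite -sw; exact: path_ratio_le.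
- exact: le_trans (hD _ _ Fz) (DM _).
Qed.

Section Measures.
Context (mu : V -> borel_probability R m) (hmu : is_selfsimilar_measure I mu).
Local Open Scope ereal_scope.

(** Only the term of the current edge is kept in the self-similarity sum, once for each letter of
    [w]. *)
Lemma measure_path_ge v w (A : set (borel_rV R m)) : is_path v w -> measurable A ->
  (path_weight I w)%:E * mu (path_end v w) (path_simil I w @^-1` A) <= mu v A.
Proof.
elim: w v A => [|e w IH] v A.
  by rewrite /path_weight big_nil mul1e.
move=> /= /andP[/eqP ev pw] mA.
have mA' : measurable (simil I e @^-1` A : set (borel_rV R m)).
  exact: (measurable_path_simil [:: e]).
rewrite (hmu v mA) (bigD1 e) ?ev//=.
apply: (@le_trans _ _ ((weight I e)%:E * mu (ter e) (simil I e @^-1` A))).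
  rewrite /path_weight big_cons EFinM -muleA lee_pmul2l ?lte_fin ?weight_gt0//.
  exact: IH.
rewrite leeDl// sume_ge0// => f _.
by rewrite mule_ge0// lee_fin ltW// weight_gt0.
Qed.

Let far v (s : R) : set (borel_rV R m) := [set y | forall z, F v z -> (s <= eudist y z)%R].

Let measurable_far v s : measurable (far v s).
Proof.
rewrite -[far v s]setCK; apply: measurableC; apply: sub_sigma_algebra.
by rewrite openC; exact: closed_far.
Qed.

(** Continuity from above: every point is at finite distance from a point of [F v], so these
    decreasing sets have empty intersection. *)
Let measure_far_cvg0 v : mu v (far v n%:R) @[n --> \oo] --> 0.
Proof.
have cap0 : \bigcap_n far v n%:R = set0.
  apply/seteqP; split => // y h; have [x Fx] : F v !=set0 by have [] := hF v.
  have := h (Num.truncn (eudist y x)).+1 Logic.I x Fx.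
  by apply/negP; rewrite -ltNge real_truncnS_gt// num_real.
rewrite -(measure0 (mu v)) -cap0.
apply: nonincreasing_cvg_mu => //.
- by rewrite (le_lt_trans (probability_le1 _ _))// ltry.
- by apply: bigcap_measurable => // k _; exact: measurable_far.
- move=> i j ij; apply/subsetPset => y h z Fz; apply: le_trans (h z Fz).
  by rewrite ler_nat.
Qed.

(* An edge map pulls the points at distance at least [s] from the attractor back
   to points at distance at least [s / c]; iterating, their mass is at most the
   mass arbitrarily far out. *)
Let measure_far0 v (s : R) : (0 < s)%R -> mu v (far v s) = 0.
Proof.
move=> s0; apply/eqP; rewrite eq_le measure_ge0 andbT; apply/lee_addgt0Pr => eps eps0.
rewrite add0e.
have [c /andP[c0 c1] hc] := ratio_ubound_lt1.
(* The bound is carried for all vertices at once because edges change the vertex; averaging with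
   weights of sum 1 preserves it. *)
have step t : (0 < t)%R -> (forall v, mu v (far v (t / c)) <= eps%:E) ->
    forall v, mu v (far v t) <= eps%:E.
  move=> t0 h v'; rewrite hmu//.
  apply: (@le_trans _ _ (\sum_(e | ini e == v') (weight I e)%:E * eps%:E)).
    apply: lee_sum => e /eqP ev.
    rewrite lee_pmul2l ?lte_fin ?weight_gt0//.
    apply: le_trans (h (ter e)); apply: le_measure; rewrite ?inE.
    - exact: (measurable_path_simil [:: e]).
    - exact: measurable_far.
    move=> y /= hy z Fz.
    have := hy (simil I e z); rewrite -ev => /(_ (attractor_sub _)) H.
    have {H} : (t <= eudist (simil I e y) (simil I e z))%R by apply: H; exists z.
    rewrite (similP I e).2 ler_pdivrMr// => /le_trans; apply.
    by rewrite mulrC ler_wpM2l ?eudist_ge0.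
  by rewrite -ge0_sume_distrl ?sumEFin ?weight_sum1 ?mul1e//= => e _; rewrite lee_fin ltW// weight_gt0.
have iter k : (forall v, mu v (far v (s / c ^+ k)) <= eps%:E) ->
    forall v, mu v (far v s) <= eps%:E.
  elim: k => [|k IH] h; first by move=> v'; have := h v'; rewrite expr0 divr1.
  apply: IH; apply: step; first by rewrite divr_gt0// exprn_gt0.
  by move=> v'; have := h v'; rewrite exprSr invfM mulrA.
have [n hn] : exists n, forall v, mu v (far v n%:R) <= eps%:E.
  have : \forall n \near \oo, forall v, mu v (far v n%:R) <= eps%:E.
    apply: filter_forall => v'.
    have /fine_cvgP[fin /cvgr0Pnorm_lt/(_ _ eps0) H] := measure_far_cvg0 v'.
    near=> n; rewrite -[mu _ _]fineK; last by near: n.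
    rewrite lee_fin (le_trans (ler_norm _))// ltW//.
    by near: n.
  by move=> [n _ /(_ n (leqnn n))]; exists n.
(* After [k] pull-backs the threshold [s / c ^+ k] exceeds [n]. *)
have [k hk] : exists k, (c ^+ k * n%:R < s)%R.
  have n0 : (0 < n.+1%:R :> R)%R by rewrite ltr0n.
  have := @cvg_expr R c _; rewrite ger0_norm ?ltW// => /(_ c1)/cvgr0Pnorm_lt.
  move=> /(_ (s / n.+1%:R)%R (divr_gt0 s0 n0)) [k _ /(_ k (leqnn k))] /=.
  rewrite ger0_norm ?exprn_ge0 ?ltW// ltr_pdivlMr// => hk; exists k.
  by apply: le_lt_trans hk; rewrite ler_pM2l ?exprn_gt0// ler_nat.
apply: (iter k) => v'; apply: le_trans (hn v'); apply: le_measure; rewrite ?inE//.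
move=> y h z Fz; apply: le_trans (h z Fz).
by rewrite ler_pdivlMr ?exprn_gt0// mulrC ltW.
Unshelve. all: by end_near.
Qed.

(** As [F v] is closed, its complement is the countable union of the null sets
    [far v n.+1%:R^-1]. *)
Lemma measure_off_attractor v (A : set (borel_rV R m)) : measurable A ->
  A `&` F v = set0 -> mu v A = 0.
Proof.
move=> mA AF; apply/negligibleP => //.
apply: (@negligibleS _ _ _ (mu v) (\bigcup_n far v n.+1%:R^-1)).
  move=> y Ay.
  have nFy : (~` F v) y by move=> Fy; have : (A `&` F v) y by []; rewrite AF.
  have /open_eudistP/(_ _ nFy)[e e0 eF] : open (~` F v).
    by rewrite openC; exact: attractor_closed.
  exists (Num.truncn e^-1) => // z Fz; rewrite leNgt; apply/negP => h.
  apply: (eF z _ Fz) => /=; apply: lt_trans h _.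
  rewrite invf_plt ?posrE ?ltr0n//.
  by rewrite real_truncnS_gt// num_real.
apply: negligible_bigcup => n; apply/negligibleP; first exact: measurable_far.
by apply: measure_far0; rewrite invr_gt0.
Qed.

Lemma measure_attractor_sub v (A : set (borel_rV R m)) : measurable A ->
  F v `<=` A -> mu v A = 1.
Proof.
move=> mA FA; have := probability_setC (mu v) mA.
rewrite (@measure_off_attractor _ (~` A)); first last.
- by apply/seteqP; split => // x [nA /FA].
- exact: measurableC.
move=> h; have := fin_num_measure (mu v) _ mA.
by move: h; case: (mu v A) => //= r [] h _; congr EFin; lra.
Qed.

End Measures.
End Attractor.
End IFS.

(** * Codes *)

Section WordCodes.
Context {R : realType} {m : nat} {G : digraph} (I : ifs_prob R m G).
Local Notation V := (vertex G).
Local Notation E := (edge G).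
Local Notation ratio := Defs.ratio.
Local Notation is_path := (is_path (@ini G) (@ter G)).
Local Notation path_end := (path_end (@ter G)).
Implicit Types (v : V) (w b : seq E).

Definition edges_from v : seq (seq E) := [seq [:: e] | e <- enum [pred e | ini e == v]].

Fixpoint paths (k : nat) v : seq (seq E) :=
  if k is k'.+1 then [seq b ++ w | b <- edges_from v, w <- paths k' (path_end v b)]
  else [:: [::]].

(* The words cut at the first block that brings the contraction ratio, started
   at [rho], down to [t]; [n] is fuel. *)
Fixpoint words (ch : V -> seq (seq E)) (t : R) (n : nat) v (rho : R) : seq (seq E) :=
  if n is n'.+1 then
    if rho <= t then [:: [::]] else
    [seq b ++ w | b <- ch v,
                  w <- words ch t n' (path_end v b) (rho * path_ratio I b)]
  else [:: [::]].

Lemma edges_fromP v b : reflect (exists2 e, ini e = v & b = [:: e]) (b \in edges_from v).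
Proof.
apply: (iffP mapP) => [[e]|[e ev ->]]; first by rewrite mem_enum inE => /eqP; exists e.
by exists e => //; rewrite mem_enum inE ev.
Qed.

Lemma mem_paths k v w : (w \in paths k v) = (size w == k) && is_path v w.
Proof.
elim: k v w => [|k IH] v w.
  by rewrite inE; case: w.
apply/allpairsPdep/andP => [[b [w' [/edges_fromP[e ev ->] + ->]]]|[]].
  by rewrite IH => /andP[/eqP <- pw] /=; rewrite ev !eqxx.
case: w => //= e w sw /andP[/eqP ev pw].
exists [:: e], w; split => //; first by apply/edges_fromP; exists e.
by rewrite IH -eqSS sw.
Qed.

Section RatioBounds.
Context (ch : V -> seq (seq E)) (t : R).

(** The condition on [c ^+ n] says that the fuel suffices: when it runs out, the ratio is already at
    most [t]. *)
Lemma words_ratio_le c n v rho w : 0 < rho -> 0 < c ->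
  (forall v b, b \in ch v -> path_ratio I b <= c) -> rho * c ^+ n <= t ->
  w \in words ch t n v rho -> rho * path_ratio I w <= t.
Proof.
move=> rho0 c0 hc; elim: n v rho w rho0 => [|n IH] v rho w rho0 /=.
  by rewrite inE mulr1 => ht /eqP->; rewrite /path_ratio big_nil mulr1.
case: ifP => [rt _|_ ht].
  by rewrite inE => /eqP->; rewrite /path_ratio big_nil mulr1.
move=> /allpairsPdep[b [w' [hb hw' ->]]].
rewrite path_ratio_cat mulrA; apply: IH hw'; first by rewrite mulr_gt0// path_ratio_gt0.
apply: le_trans ht; rewrite exprS mulrA ler_wpM2r ?exprn_ge0 ?(ltW c0)//.
by rewrite ler_pM2l// (hc v).
Qed.

(** The last block was appended while the ratio was above [t] and costs at most a factor [c]; the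
    entry [rho] of the minimum covers the empty word. *)
Lemma words_ratio_ge c n v rho w : 0 < rho -> 0 < c -> 0 < t ->
  (forall v b, b \in ch v -> c <= path_ratio I b) ->
  w \in words ch t n v rho -> Num.min rho (t * c) <= rho * path_ratio I w.
Proof.
move=> rho0 c0 t0 hc; elim: n v rho w rho0 => [|n IH] v rho w rho0 /=.
  by rewrite inE => /eqP->; rewrite /path_ratio big_nil mulr1 ge_min lexx.
case: ifP => [rt|/negbT]; last rewrite -ltNge => tr.
  by rewrite inE => /eqP->; rewrite /path_ratio big_nil mulr1 ge_min lexx.
move=> /allpairsPdep[b [w' [hb hw' ->]]].
have := IH _ _ _ _ hw'; rewrite path_ratio_cat mulrA.
move=> /(_ (mulr_gt0 rho0 (path_ratio_gt0 I b))); apply: le_trans.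
rewrite le_min ge_min [X in _ && X]ge_min lexx !orbT andbT.
apply/orP; right; apply: ler_pM; [exact: ltW|exact: ltW|exact: ltW|exact: hc hb].
Qed.

(** A block is tested only where the ratio before it still exceeds [t], which is what the separation
    estimate requires. *)
Lemma words_filter (ok : V -> seq E -> bool) n v rho w :
  w \in words ch t n v rho ->
  (forall a b c, w = a ++ b ++ c -> b \in ch (path_end v a) ->
     t < rho * path_ratio I a -> ok (path_end v a) b) ->
  w \in words (fun v => [seq b <- ch v | ok v b]) t n v rho.
Proof.
elim: n v rho w => [|n IH] v rho w //=.
case: ifP => // /negbT; rewrite -ltNge => tr.
move=> /allpairsPdep[b [w' [hb hw' ->]]] hok.
apply/allpairsPdep; exists b, w'; split => //.
  rewrite mem_filter hb andbT.
  by apply: (hok [::] b w') => //; rewrite /path_ratio big_nil mulr1.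
apply: IH hw' _ => a b' c wE hb' ht.
have := hok (b ++ a) b' c; rewrite path_end_cat path_ratio_cat mulrA.
by apply => //; rewrite wE catA.
Qed.

(** For a multiplicative [g], replacing a word by its one-block extensions does not increase the sum
    when [h] is a supersolution; the depth of the cut is then irrelevant. *)
Lemma words_sum_le (g : seq E -> R) (h : V -> R) n v rho :
  g [::] = 1 -> (forall a b, g (a ++ b) = g a * g b) -> (forall w, 0 <= g w) ->
  (forall v, \sum_(b <- ch v) g b * h (path_end v b) <= h v) ->
  \sum_(w <- words ch t n v rho) g w * h (path_end v w) <= h v.
Proof.
move=> g1 gM g0 hh; elim: n v rho => [|n IH] v rho /=.
  by rewrite big_seq1 g1 mul1r.
case: ifP => _; first by rewrite big_seq1 g1 mul1r.
rewrite big_allpairs_dep/=; apply: le_trans (hh v).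
apply: ler_sum => b _.
under eq_bigr do rewrite gM path_end_cat -mulrA.
by rewrite -mulr_sumr ler_wpM2l.
Qed.

End RatioBounds.

Section Codes.
Context (F U : V -> set 'rV[R]_m) (mu : V -> borel_probability R m).
Hypotheses (hF : is_attractor I F) (hmu : is_selfsimilar_measure I mu)
  (hU : osc_sets I U).

(** Abstracts a complete cut of the tree of paths from [v], through properties that survive
    substitution of further cuts. *)
Record word_code v (s : seq (seq E)) : Prop := WordCode {
  code_path : forall w, w \in s -> is_path v w;
  code_uniq : uniq s;
  code_disj : forall w w' x x', w \in s -> w' \in s -> w != w' ->
    U (path_end v w) x -> U (path_end v w') x' ->
    path_simil I w x <> path_simil I w' x';
  code_measure : forall A : set (borel_rV R m), measurable A ->
    (mu v A <= \sum_(w <- s) (path_weight I w)%:E *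
                 mu (path_end v w) (path_simil I w @^-1` A))%E;
  code_cover : forall x, F v x -> exists2 w, w \in s &
    exists2 y, F (path_end v w) y & x = path_simil I w y
}.

Lemma code_nil v : word_code v [:: [::]].
Proof.
split => //.
- by move=> w; rewrite inE => /eqP->.
- by move=> w w' x x'; rewrite !inE => /eqP-> /eqP->; rewrite eqxx.
- move=> A mA; rewrite big_seq1 /path_weight big_nil mul1e//.
- by move=> x Fx; exists [::]; rewrite ?inE//; exists x.
Qed.

Lemma code_edges v : word_code v (edges_from v).
Proof.
have [_ _ Udisj] := hU.
split.
- by move=> _ /edges_fromP[e <- ->] /=; rewrite eqxx.
- by rewrite map_inj_uniq ?enum_uniq// => e e' [].
- move=> _ _ x x' /edges_fromP[e ev ->] /edges_fromP[e' ev' ->] ee' Ux Ux' /= h.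
  have : (simil I e @` U (ter e) `&` simil I e' @` U (ter e')) (simil I e x).
    by split; [exists x|exists x'].
  by rewrite (Udisj e e') ?ev'// => eE; rewrite eE eqxx in ee'.
- move=> A mA; rewrite hmu// big_map big_enum/=.
  rewrite (eq_bigr (fun e => ((path_weight I [:: e])%:E *
    mu (ter e) (simil I e @^-1` A))%E)) ?lexx// => e _.
  by rewrite /path_weight big_seq1.
- move=> x /(attractor_edge hF)[e [y [ev Fy ->]]].
  by exists [:: e]; [apply/edges_fromP; exists e|exists y].
Qed.

Lemma code_bind v s (t : seq E -> seq (seq E)) : word_code v s ->
  (forall b, b \in s -> word_code (path_end v b) (t b)) ->
  word_code v [seq b ++ w | b <- s, w <- t b].
Proof.
move=> cs ct; have [U0 US _] := hU.
(* Either the prefixes differ and [s] already separates the cells, or they agree and injectivity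
   reduces the claim to [t b]. *)
have disj b b' w w' x x' : b \in s -> b' \in s -> w \in t b -> w' \in t b' ->
    (b != b') || (w != w') ->
    U (path_end v (b ++ w)) x -> U (path_end v (b' ++ w')) x' ->
    path_simil I (b ++ w) x <> path_simil I (b' ++ w') x'.
  move=> sb sb' tw tw' ne; rewrite !path_end_cat !path_simil_cat => Ux Ux'.
  have [bb'|bb'] := eqVneq b b'; last first.
    apply: (code_disj cs sb sb' bb').
    - exact: path_simil_sub US (code_path (ct _ sb) tw) Ux.
    - exact: path_simil_sub US (code_path (ct _ sb') tw') Ux'.
  move: ne Ux' tw'; rewrite -bb' eqxx /= => ne Ux' tw' /path_simil_inj.
  exact: (code_disj (ct _ sb) tw tw' ne).
split.
- move=> _ /allpairsPdep[b [w [sb tw ->]]]; rewrite is_path_cat.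
  by rewrite (code_path cs sb) (code_path (ct _ sb) tw).
- apply: allpairs_uniq_dep; first exact: code_uniq cs.
    by move=> b sb; exact: code_uniq (ct _ sb).
  move=> [? ?] [? ?] /allpairsPdep[b [w [sb tw [-> ->]]]].
  move=> /allpairsPdep[b' [w' [sb' tw' [-> ->]]]] /= bwE.
  (* Two factorizations of one word would give two disjoint open cells with a common point. *)
  have [[x Ux] _ _] := U0 (path_end v (b ++ w)).
  have [/andP[/eqP bb /eqP ww]|] := boolP ((b == b') && (w == w')); first by rewrite bb ww.
  rewrite negb_and => ne; exfalso.
  apply: (disj _ _ _ _ x x sb sb' tw tw' ne Ux); first by rewrite -bwE.
  by rewrite bwE.
- move=> _ _ x x' /allpairsPdep[b [w [sb tw ->]]] /allpairsPdep[b' [w' [sb' tw' ->]]].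
  move=> ne; apply: disj => //; apply: contraNT ne.
  by rewrite negb_or !negbK => /andP[/eqP-> /eqP->].
- move=> A mA; rewrite big_allpairs_dep/=; apply: le_trans (code_measure cs mA) _.
  rewrite big_seq [leRHS]big_seq; apply: lee_sum => b sb.
  have mA' := measurable_path_simil I b mA.
  apply: (@le_trans _ _ ((path_weight I b)%:E * (\sum_(w <- t b)
     (path_weight I w)%:E * mu (path_end (path_end v b) w)
       (path_simil I w @^-1` (path_simil I b @^-1` A))))%E).
    by rewrite lee_pmul2l ?lte_fin ?path_weight_gt0//; have := code_measure (ct _ sb) mA'.
  rewrite ge0_sume_distrr; last first.
    by move=> w _; rewrite mule_ge0// lee_fin ltW// path_weight_gt0.
  rewrite le_eqVlt; apply/orP; left; apply/eqP; apply: eq_bigr => w _.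
  rewrite path_weight_cat EFinM muleA path_end_cat; congr (_ * mu _ _)%E.
  by apply/seteqP; split=> x /=; rewrite path_simil_cat.
- move=> x /(code_cover cs)[b sb [y /(code_cover (ct _ sb))[w tw [z Fz ->]] ->]].
  exists (b ++ w); first by apply/allpairsPdep; exists b, w.
  by exists z; rewrite ?path_end_cat ?path_simil_cat.
Qed.

Lemma code_paths k v : word_code v (paths k v).
Proof.
elim: k v => [|k IH] v; first exact: code_nil.
by apply: code_bind => //; exact: code_edges.
Qed.

Lemma code_words k t n v rho : word_code v (words (paths k) t n v rho).
Proof.
elim: n v rho => [|n IH] v rho /=; first exact: code_nil.
case: ifP => _; first exact: code_nil.
by apply: code_bind => //; exact: code_paths.
Qed.

End Codes.
End WordCodes.

(** * Cells of the overlap *)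

(** The upper bound on [x] is used for [s >= 0], the lower one for [s < 0]; the constant adds both
    cases. *)
Lemma powR_le_scale {R : realType} (s lo hi : R) : 0 < lo -> 0 < hi ->
  exists2 C, 0 < C & forall x r, 0 < r -> lo * r <= x <= hi * r ->
    x `^ s <= C * r `^ s.
Proof.
move=> lo0 hi0; exists (lo `^ s + hi `^ s); first by rewrite addr_gt0// powR_gt0.
move=> x r r0 /andP[lx xh].
have x0 : 0 < x by apply: lt_le_trans lx; rewrite mulr_gt0.
have [s0|s0] := leP 0 s.
  apply: (@le_trans _ _ ((hi * r) `^ s)).
    by apply: ge0_ler_powR => //; rewrite nnegrE ltW// mulr_gt0.
  by rewrite (powRM _ (ltW hi0) (ltW r0)) ler_wpM2r ?powR_ge0// lerDr powR_ge0.
apply: (@le_trans _ _ ((lo * r) `^ s)).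
  rewrite -[s]opprK !(powRN _ (- s)) lef_pV2 ?posrE ?powR_gt0 ?mulr_gt0//.
  by apply: ge0_ler_powR => //; rewrite ?oppr_ge0 ?nnegrE ltW// mulr_gt0.
by rewrite (powRM _ (ltW lo0) (ltW r0)) ler_wpM2r ?powR_ge0// lerDl powR_ge0.
Qed.

Lemma seq_max {R : realType} {T : eqType} (s : seq T) (f : T -> R) : s != [::] ->
  exists2 x, x \in s & forall y, y \in s -> f y <= f x.
Proof.
elim: s => // a [|b s] IH _; first by exists a; rewrite ?inE// => y; rewrite inE => /eqP->.
have [//|x xs hx] := IH; have [ax|/ltW xa] := leP (f a) (f x).
  exists x; first by rewrite inE xs orbT.
  by move=> y; rewrite inE => /orP[/eqP->//|]; exact: hx.
exists a; first by rewrite inE eqxx.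
by move=> y; rewrite inE => /orP[/eqP->//|/hx/le_trans]; apply.
Qed.

Section Cells.
Context {R : realType} {m : nat} {G : digraph} (I : ifs_prob R m G).
Local Notation V := (vertex G).
Local Notation E := (edge G).
Local Notation ratio := Defs.ratio.
Local Notation is_path := (is_path (@ini G) (@ter G)).
Local Notation path_end := (path_end (@ter G)).
Context (F U : V -> set 'rV[R]_m) (mu : V -> borel_probability R m).
Hypotheses (hF : is_attractor I F) (hmu : is_selfsimilar_measure I mu)
  (hU : osc_sets I U).
Context (l : nat) (hl : (0 < l)%N) (lw : V -> l.-tuple E).
Context (c : R) (c0 : 0 < c) (hc : forall v x y, F (path_end v (lw v)) x ->
  eudist (path_simil I (lw v) x) y < c -> U v y).
Context (a : V -> 'rV[R]_m) (eps : R) (eps0 : 0 < eps)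
  (ha : forall v y, eudist (a v) y < eps -> U v y).
Context (D : R) (D0 : 0 < D) (hDa : forall v x, F v x -> eudist x (a v) <= D)
  (hD : forall v x y, F v x -> F v y -> eudist x y <= D).
Context (c1 c2 pmin : R) (c10 : 0 < c1) (c20 : 0 < c2) (c21 : c2 < 1) (pmin0 : 0 < pmin)
  (hc1 : forall e, c1 <= ratio I e) (hc2 : forall e, ratio I e <= c2)
  (hp : forall e, pmin <= weight I e).

Lemma special_block_far g w h x y (v := path_end (ter g) w) :
  ini h = ini g -> h <> g -> is_path (ter g) w ->
  F (path_end v (lw v)) x -> F (ter h) y ->
  path_ratio I (g :: w) * c <=
    eudist (path_simil I (g :: w) (path_simil I (lw v) x)) (simil I h y).
Proof.
have [U0 US Udisj] := hU.
move=> hg hng pw Fx Fy; rewrite leNgt; apply/negP => lt.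
(* The approximation error is the slack in the inequality assumed for contradiction. *)
have [z Uz yz] : exists2 z, U (ter h) z & eudist y z <
    path_ratio I (g :: w) * c -
    eudist (path_simil I (g :: w) (path_simil I (lw v) x)) (simil I h y).
  apply: (attractor_closure hF _ US Fy); last by rewrite subr_gt0.
  by move=> v'; have [] := U0 v'.
(* Surjectivity lets the nearby point of the [h]-cell be pulled back along [g :: w], where the gap
   [c] places it in [U v]. *)
have [z' z'E] := path_simil_surj I (g :: w) (simil I h z).
have Uz' : U v z'.
  apply: (hc Fx); rewrite -(ltr_pM2l (path_ratio_gt0 I (g :: w))).
  rewrite -eudist_path_simil z'E.
  apply: le_lt_trans (eudist_triangle (simil I h y) _ _) _.
  rewrite -ltrBrDl; apply: le_lt_trans yz.
  rewrite (similP I h).2 ler_piMl ?eudist_ge0//.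
  exact: le_trans (hc2 h) (ltW c21).
have : (simil I g @` U (ter g) `&` simil I h @` U (ter h)) (simil I h z).
  split; last by exists z.
  exists (path_simil I w z') => //.
  exact: path_simil_sub US pw Uz'.
by rewrite Udisj// => gh; apply: hng.
Qed.

(** The first edge is split off unconditionally: it decides which of the overlapping pieces a cell
    belongs to. *)
Definition cells (ch : V -> seq (seq E)) (t : R) n u : seq (seq E) :=
  [seq b ++ w | b <- edges_from u, w <- words I ch t n (path_end u b) (path_ratio I b)].

Definition good v : seq (seq E) := [seq b <- paths l v | b != lw v :> seq E].

Lemma code_cells t n u : word_code I F U mu u (cells (paths l) t n u).
Proof.
apply: code_bind => //; first exact: code_edges.
by move=> b _; exact: code_words.
Qed.

(** The first edge of a cell near [x] is not known in advance, so every [g] must have a competing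
    edge whose piece is near [x]. *)
Definition overlap u r x := forall g, ini g = u -> exists h z,
  [/\ ini h = u, h <> g, F (ter h) z & eudist x (simil I h z) < 2 * r].

Lemma cells_good u r n w x y : 0 < r -> overlap u r x ->
  w \in cells (paths l) (3 * r / c) n u -> F (path_end u w) y ->
  eudist x (path_simil I w y) <= r -> w \in cells good (3 * r / c) n u.
Proof.
move=> r0 ov hw Fy xy.
have pw := code_path (code_cells _ _ _) hw.
move: hw pw Fy xy => /allpairsPdep[_ [w' [/edges_fromP[g gu ->] hw' ->]]] pw Fy xy.
apply/allpairsPdep; exists [:: g], w'; split=> //.
  by apply/edges_fromP; exists g.
apply: words_filter hw' _ => a' b c' w'E _ tr; apply/negP => /eqP bE.
have [h [z [hu hg Fz xz]]] := ov g gu.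
move: pw Fy xy; rewrite w'E /= gu eqxx /= !is_path_cat => /and3P[pa pb pc'].
rewrite /path_end/= -/(path_end _ _) !path_end_cat => Fy xy.
rewrite -[path_end (ter g) a']/(path_end (path_end u [:: g]) a') in bE Fy pa pb pc'.
have Fc : F (path_end (path_end (path_end u [:: g]) a') b) (path_simil I c' y).
  exact: path_simil_sub (attractor_sub hF) pc' Fy.
rewrite bE in Fc.
(* This lower bound exceeds [3 * r], while the triangle inequality through [x] gives less than
   [r + 2 * r]. *)
have := @special_block_far g a' h _ z (etrans hu (esym gu)) hg pa Fc Fz.
rewrite -bE; rewrite ltr_pdivrMr// in tr.
have -> : path_simil I (g :: a') (path_simil I b (path_simil I c' y)) =
    simil I g (path_simil I (a' ++ b ++ c') y) by rewrite !path_simil_cat.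
have := eudist_triangle x (simil I g (path_simil I (a' ++ b ++ c') y)) (simil I h z).
rewrite [eudist _ x]eudistC.
move: tr; rewrite -path_ratio_cat /=; lra.
Qed.

Lemma size_paths (v : V) b : b \in paths l v -> size b = l.
Proof. by rewrite mem_paths => /andP[/eqP]. Qed.

Lemma size_good (v : V) b : b \in good v -> size b = l.
Proof. by rewrite mem_filter => /andP[_ /size_paths]. Qed.

Lemma fuel_exists t : 0 < t -> exists n, c2 ^+ n <= t.
Proof.
move=> t0; have := @cvg_expr R c2 _; rewrite ger0_norm ?ltW// => /(_ c21)/cvgr0Pnorm_lt.
move=> /(_ t t0) [k _ /(_ k (leqnn k))] /=.
by rewrite ger0_norm ?exprn_ge0 ?ltW// => hk; exists k; exact: ltW.
Qed.

Let kappa := 3 / c.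
(** The two entries correspond to a word cut right after its first edge and to one cut after a block
    of length [l]. *)
Let beta := Num.min c1 (kappa * c1 ^+ l).

Let kappa0 : 0 < kappa. Proof. by rewrite divr_gt0. Qed.
Let beta0 : 0 < beta.
Proof. by rewrite lt_min c10 mulr_gt0// exprn_gt0. Qed.

Lemma cells_ratio ch u r n w : (forall v b, b \in ch v -> size b = l) ->
  0 < r < 1 -> c2 ^+ n <= kappa * r -> w \in cells ch (kappa * r) n u ->
  beta * r <= path_ratio I w <= kappa * r.
Proof.
move=> hch /andP[r0 r1] hn /allpairsPdep[_ [w' [/edges_fromP[g gu ->] hw' ->]]].
have g0 : 0 < path_ratio I [:: g] by exact: path_ratio_gt0.
have gE : path_ratio I [:: g] = ratio I g by rewrite /path_ratio big_seq1.
have t0 : 0 < kappa * r by rewrite mulr_gt0.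
rewrite path_ratio_cat; apply/andP; split.
  have hge v b : b \in ch v -> c1 ^+ l <= path_ratio I b.
    by move=> /hch <-; exact: path_ratio_ge.
  apply: le_trans (words_ratio_ge g0 (exprn_gt0 l c10) t0 hge hw').
  rewrite le_min; apply/andP; split.
    rewrite gE (le_trans _ (hc1 g))// (@le_trans _ _ beta)//.
      by rewrite ler_piMr// ltW.
    by rewrite ge_min lexx.
  by rewrite mulrAC ler_wpM2r ?(ltW r0)// ge_min lexx orbT.
(* A block is nonempty as [0 < l], so it contracts at least by [c2]. *)
apply: (words_ratio_le g0 c20 _ _ hw') => [v b /hch sb|].
  apply: le_trans (path_ratio_le _ hc2) _.
  rewrite sb -(prednK hl) exprS ler_piMr ?(ltW c20)//.
  by rewrite exprn_ile1 ?ltW.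
apply: le_trans hn; rewrite ler_piMl ?exprn_ge0 ?ltW//.
by rewrite gE (le_lt_trans (hc2 g)).
Qed.

(** * Cells meeting a ball, and the mass of balls *)

Definition hit r x u w := `[< exists2 y, F (path_end u w) y &
  eudist x (path_simil I w y) <= r >].

(** The open cells are disjoint and each contains a ball of radius comparable to [r], so their
    centres are separated and stay near [x]. *)
Lemma hits_bounded : exists K : nat, forall u r x n, 0 < r < 1 ->
  c2 ^+ n <= kappa * r ->
  (size [seq w <- cells (paths l) (kappa * r) n u | hit r x u w] <= K)%N.
Proof.
have A0 : 0 < 1 + kappa * D by rewrite addr_gt0// mulr_gt0.
have [K HK] := @packing_bound R m _ _ A0 (mulr_gt0 beta0 eps0).
exists K => u r x n r01 hn; have /andP[r0 r1] := r01.
pose f w := path_simil I w (a (path_end u w)).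
apply: (HK r x _ _ f) => //.
- by rewrite filter_uniq// (code_uniq (code_cells _ _ _)).
- move=> w; rewrite mem_filter => /andP[/asboolP[y Fy xy] /(cells_ratio size_paths r01 hn)/andP[_ wr]].
  apply: le_trans (eudist_triangle (path_simil I w y) _ _) _.
  rewrite eudist_path_simil mulrDr mulr1 lerD// mulrA [r * _]mulrC.
  by apply: ler_pM; [exact/ltW/path_ratio_gt0|exact: eudist_ge0|exact: wr|exact: hDa].
move=> w w'; rewrite !mem_filter => /andP[_ hw] /andP[_ hw'] ww'.
have /andP[br _] := cells_ratio size_paths r01 hn hw.
(* If the centres were too close, the centre of the cell of [w'] would lie in the open cell of
   [w]. *)
rewrite mulrA [r * _]mulrC leNgt; apply/negP => lt.
have [z zE] := path_simil_surj I w (f w').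
apply: (code_disj (code_cells _ _ _) hw hw' ww' _ _ zE); last first.
  by apply: ha; rewrite eudistxx.
apply: ha; rewrite -(ltr_pM2l (path_ratio_gt0 I w)) -eudist_path_simil zE.
by apply: lt_le_trans lt _; rewrite ler_wpM2r// ltW.
Qed.

Lemma measurable_euball x r : measurable (euball x r : set (borel_rV R m)).
Proof.
rewrite -[euball x r]setCK; apply: measurableC; apply: sub_sigma_algebra.
by rewrite openC; exact: closed_euball.
Qed.

Definition ball_mass u x r : R := fine (mu u (euball x r)).

Lemma ball_massE u x r : mu u (euball x r) = (ball_mass u x r)%:E.
Proof. by rewrite /ball_mass fineK// fin_num_measure//; exact: measurable_euball. Qed.

Lemma ball_mass_ge0 u x r : 0 <= ball_mass u x r.
Proof. by rewrite fine_ge0. Qed.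

(** Only cells meeting the ball contribute; they are boundedly many, and the heaviest of them
    dominates. *)
Lemma ball_mass_le : exists2 A : R, 0 < A & forall u r x n, 0 < r < 1 ->
  c2 ^+ n <= kappa * r -> F u x ->
  exists w, [/\ w \in cells (paths l) (kappa * r) n u, hit r x u w &
    ball_mass u x r <= A * path_weight I w].
Proof.
have [K HK] := hits_bounded.
exists K.+1%:R => // u r x n r01 hn Fx.
have code := code_cells (kappa * r) n u.
set W := cells _ _ _ _ in code *; pose H := [seq w <- W | hit r x u w].
have Hn : H != [::].
  have [w Ww [y Fy xE]] := code_cover code Fx.
  have : w \in H.
    rewrite mem_filter Ww andbT; apply/asboolP; exists y => //.
    by rewrite -xE eudistxx ltW//; have /andP[] := r01.
  by case: (H).
have [w] := seq_max (path_weight I) Hn; rewrite mem_filter => /andP[hw Ww] wmax.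
exists w; split => //.
rewrite -lee_fin -ball_massE.
apply: le_trans (code_measure code (measurable_euball x r)) _.
apply: (@le_trans _ _ (\sum_(w' <- H) (path_weight I w')%:E)%E).
  rewrite /H big_filter [leRHS]big_mkcond/= big_seq [leRHS]big_seq.
  apply: lee_sum => w' Ww'.
  have mB := measurable_path_simil I w' (measurable_euball x r).
  case: ifPn => [_|nh].
    rewrite -[leRHS]mule1 lee_pmul2l ?lte_fin ?path_weight_gt0//.
    exact: probability_le1.
  rewrite (measure_off_attractor hF hmu mB) ?mule0//.
  apply/seteqP; split => // y [By Fy]; apply: (negP nh).
  by apply/asboolP; exists y.
rewrite sumEFin lee_fin.
apply: (@le_trans _ _ (\sum_(w' <- H) path_weight I w)).
  rewrite big_seq [leRHS]big_seq; apply: ler_sum => w' Hw'; exact: wmax.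
rewrite big_const_seq count_predT iter_addr_0 -[leLHS]mulr_natl ler_pM2r ?path_weight_gt0//.
by rewrite ler_nat ltnW// ltnS HK.
Qed.

(** Inside the cell containing [x], a subcell a fixed number [k] of levels deeper fits into the ball
    and keeps at least the fraction [pmin ^+ k] of the weight. *)
Lemma ball_mass_ge : exists2 A : R, 0 < A & forall u r x n, 0 < r < 1 ->
  c2 ^+ n <= kappa * r -> F u x ->
  exists w, [/\ w \in cells (paths l) (kappa * r) n u, hit r x u w &
    A * path_weight I w <= ball_mass u x r].
Proof.
have [|k hk] := @fuel_exists (kappa * D)^-1; first by rewrite invr_gt0 mulr_gt0.
exists (pmin ^+ k); first by rewrite exprn_gt0.
move=> u r x n r01 hn Fx; have /andP[r0 _] := r01.
have code := code_cells (kappa * r) n u.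
have [w Ww [y Fy xE]] := code_cover code Fx.
exists w; split => //.
  by apply/asboolP; exists y => //; rewrite -xE eudistxx ltW.
have [b [z [sb pb Fz yE]]] := attractor_word hF k Fy.
have pwb : is_path u (w ++ b) by rewrite is_path_cat (code_path code Ww).
rewrite -lee_fin -ball_massE.
apply: le_trans (measure_path_ge hmu pwb (measurable_euball x r)).
rewrite (measure_attractor_sub hF hmu); first last.
- move=> z' Fz'; rewrite /= /euball/= xE yE -path_simil_cat eudist_path_simil.
  rewrite path_end_cat in Fz'.
  have /andP[_ wr] := cells_ratio size_paths r01 hn Ww.
  rewrite path_ratio_cat.
  apply: (@le_trans _ _ ((kappa * r) * (kappa * D)^-1 * D)); last first.
    rewrite le_eqVlt; apply/orP; left; apply/eqP; field.
    by rewrite !gt_eqF//; exact: kappa0.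
  apply: ler_pM; last exact: hD Fz Fz'.
  - exact/ltW/mulr_gt0/path_ratio_gt0/path_ratio_gt0.
  - exact: eudist_ge0.
  apply: ler_pM; [exact/ltW/path_ratio_gt0|exact/ltW/path_ratio_gt0|exact: wr|].
  by apply: le_trans hk; rewrite -sb; exact: path_ratio_le.
- exact: measurable_path_simil (measurable_euball _ _).
rewrite mule1 lee_fin path_weight_cat mulrC ler_pM2l ?path_weight_gt0//.
by rewrite -sb; exact: path_weight_ge.
Qed.

(** For [q < 0] the power reverses inequalities, so the lower mass estimate replaces the upper
    one. *)
Lemma ball_mass_powR q : exists2 C : R, 0 < C & forall u r x n, 0 < r < 1 ->
  c2 ^+ n <= kappa * r -> F u x ->
  exists w, [/\ w \in cells (paths l) (kappa * r) n u, hit r x u w &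
    ball_mass u x r `^ q <= C * path_weight I w `^ q].
Proof.
have [q0|q0] := leP 0 q.
  have [A A0 HA] := ball_mass_le; exists (A `^ q); first by rewrite powR_gt0.
  move=> u r x n r01 hn Fx; have [w [Ww hw le]] := HA u r x n r01 hn Fx.
  exists w; split => //; rewrite -(powRM _ (ltW A0) (ltW (path_weight_gt0 I w))).
  apply: ge0_ler_powR => //; rewrite nnegrE ?ball_mass_ge0//.
  by rewrite mulr_ge0 ?ltW// path_weight_gt0.
have [A A0 HA] := ball_mass_ge; exists (A `^ q); first by rewrite powR_gt0.
move=> u r x n r01 hn Fx; have [w [Ww hw le]] := HA u r x n r01 hn Fx.
exists w; split => //; rewrite -(powRM _ (ltW A0) (ltW (path_weight_gt0 I w))).
have p0 : 0 < A * path_weight I w by rewrite mulr_gt0// path_weight_gt0.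
have b0 := lt_le_trans p0 le.
rewrite -[q]opprK !(powRN _ (- q)) lef_pV2 ?posrE ?powR_gt0//.
by apply: ge0_ler_powR => //; rewrite ?oppr_ge0 ?nnegrE ltW.
Qed.

(* Separated points charged to the same cell lie in a ball of radius comparable
   to [r], so the packing lemma bounds their number. *)
Lemma separated_sum_le q : exists2 C : R, 0 < C & forall u r n (X : seq 'rV[R]_m),
  0 < r < 1 -> c2 ^+ n <= kappa * r -> uniq X ->
  (forall x, x \in X -> F u x /\ overlap u r x) ->
  (forall x y, x \in X -> y \in X -> x != y -> 2 * r < eudist x y) ->
  \sum_(x <- X) ball_mass u x r `^ q <=
    C * \sum_(w <- cells good (kappa * r) n u) path_weight I w `^ q.
Proof.
have [C C0 HC] := ball_mass_powR q.
have A0 : 0 < 1 + kappa * D by rewrite addr_gt0// mulr_gt0.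
have [K HK] := @packing_bound R m _ 2 A0 (ltr0Sn _ 1).
exists (C * K.+1%:R); first by rewrite mulr_gt0.
move=> u r n X r01 hn uX FX sX; have /andP[r0 r1] := r01.
(* The cell charged by [x]; off [X] the empty word is a dummy value. *)
have ex x : exists w, x \in X -> [/\ w \in cells good (kappa * r) n u,
    w \in cells (paths l) (kappa * r) n u, hit r x u w &
    ball_mass u x r `^ q <= C * path_weight I w `^ q].
  have [xX|] := boolP (x \in X); last by exists [::].
  have [Fx ov] := FX x xX; have [w [Ww hw le]] := HC u r x n r01 hn Fx.
  exists w => _; split => //; have /asboolP[y Fy xy] := hw.
  have kE : kappa * r = 3 * r / c by rewrite /kappa mulrAC.
  by rewrite kE in Ww *; exact: cells_good Ww Fy xy.
pose om x := sval (cid (ex x)).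
have omP x : x \in X -> [/\ om x \in cells good (kappa * r) n u,
    om x \in cells (paths l) (kappa * r) n u, hit r x u (om x) &
    ball_mass u x r `^ q <= C * path_weight I (om x) `^ q].
  by rewrite /om; case: cid.
set W := cells good _ _ _ in omP *.
apply: (@le_trans _ _ (\sum_(x <- X) C * \sum_(w <- W | om x == w) path_weight I w `^ q)).
  rewrite big_seq [leRHS]big_seq; apply: ler_sum => x xX.
  have [oW _ _ /le_trans] := omP x xX; apply; rewrite ler_pM2l// -big_filter.
  rewrite (big_rem (om x))/=; last by rewrite mem_filter eqxx.
  by rewrite lerDl sumr_ge0// => w _; exact: powR_ge0.
rewrite -mulr_sumr -mulrA ler_pM2l//.
(* Exchanging the sums leaves each good cell with the number of points charged to it. *)
under eq_bigr do rewrite big_mkcond.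
rewrite exchange_big/= mulr_sumr big_seq [leRHS]big_seq; apply: ler_sum => w Ww.
rewrite -big_mkcond/= -big_filter big_const_seq count_predT iter_addr_0 -[leLHS]mulr_natl.
rewrite ler_wpM2r ?powR_ge0// ler_nat ltnW// ltnS.
apply: (HK r (path_simil I w (a (path_end u w))) _ _ id) => //.
- exact: filter_uniq.
- move=> x; rewrite mem_filter => /andP[/eqP <- xX].
  have [_ hw /asboolP[y Fy xy] _] := omP x xX.
  have /andP[_ wr] := cells_ratio size_paths r01 hn hw.
  rewrite eudistC.
  apply: le_trans (eudist_triangle (path_simil I (om x) y) _ _) _.
  rewrite eudist_path_simil mulrDr mulr1 lerD// mulrA [r * _]mulrC.
  by apply: ler_pM; [exact/ltW/path_ratio_gt0|exact: eudist_ge0|exact: wr|exact: hDa].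
- move=> x y; rewrite !mem_filter => /andP[_ xX] /andP[_ yX] xy.
  by rewrite mulrC ltW// sX.
Qed.

End Cells.

(** * Perron weights on the good words *)

Lemma uniq_paths (G : digraph) k (v : vertex G) : uniq (paths k v).
Proof.
elim: k v => // k IH v; apply: allpairs_uniq_dep => [|b _|]; last 2 first.
- exact: IH.
- move=> [? ?] [? ?] /allpairsPdep[b [w [/edges_fromP[e _ ->] _ [-> ->]]]].
  by move=> /allpairsPdep[b' [w' [/edges_fromP[e' _ ->] _ [-> ->]]]] /= [-> ->].
by rewrite map_inj_uniq ?enum_uniq// => e e' [].
Qed.

Section Supersolution.
Context {R : realType} {m : nat} {G : digraph} (I : ifs_prob R m G).
Local Notation V := (vertex G).
Local Notation E := (edge G).
Local Notation is_path := (is_path (@ini G) (@ter G)).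
Local Notation path_end := (path_end (@ter G)).
Context (l : nat) (lw : V -> l.-tuple E) (q gamma : R).

Let g (w : seq E) := path_weight I w `^ q * path_ratio I w `^ gamma.

(** Passes from the list of good blocks to the tuples that index the entries of [Bmatrix]. *)
Lemma good_sumE v (f : seq E -> R) :
  \sum_(b <- good lw v) f b =
  \sum_(s : l.-tuple E | is_path v s && (s != lw v)) f s.
Proof.
pose T := l.-tuple E.
pose P (s : T) := is_path v s && (s != lw v).
have -> : \sum_(s : T | P s) f s = \sum_(b <- [seq val s | s <- enum {: T} & P s]) f b.
  by rewrite big_map big_filter big_enum_cond.
apply: perm_big; apply: uniq_perm.
- by rewrite filter_uniq// uniq_paths.
- by rewrite (map_inj_uniq val_inj) filter_uniq// enum_uniq.
move=> w; rewrite mem_filter mem_paths; apply/idP/mapP.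
  move=> /and3P[wl sw pw]; exists (Tuple sw) => //.
  by rewrite mem_filter mem_enum inE andbT /P pw.
by move=> [s + ->]; rewrite mem_filter size_tuple eqxx /P => /andP[/andP[-> ->]].
Qed.

Lemma good_supersolution (v0 : V) :
  irreducible_mx (Bmatrix I lw q gamma) ->
  spectral_radius (Bmatrix I lw q gamma) = 1 ->
  exists2 h : V -> R, (forall v, 0 < h v) & forall v,
    \sum_(b <- good lw v) g b * h (path_end v b) <= h v.
Proof.
move=> irr rho1; have V0 : (0 < #|V|)%N by apply/card_gt0P; exists v0.
have [lam [h [lam0 h0 Bh]]] := perron_frobenius V0 irr.
have lam1 : lam <= 1.
  rewrite -rho1; apply: (spectral_radius_ge lam0 _ Bh).
  apply/eqP => hE; have := h0 (enum_rank v0); rewrite hE mxE ltxx//.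
exists (fun v => h (enum_rank v) 0) => // v.
(* Grouping blocks by end vertex turns the sum into a row of the matrix times the eigenvector. *)
rewrite good_sumE (partition_big (fun s : l.-tuple E => enum_rank (path_end v s)) predT)//=.
have := congr1 (fun x : 'cV[R]_#|V| => x (enum_rank v) 0) Bh.
rewrite [LHS]mxE [RHS]mxE => BhE.
apply: (@le_trans _ _ (lam * h (enum_rank v) 0)); last by rewrite ler_piMl// ltW.
rewrite -BhE; apply: ler_sum => j _; rewrite [Bmatrix _ _ _ _ _ _]mxE enum_rankK mulr_suml.
rewrite le_eqVlt; apply/orP; left; apply/eqP; apply: eq_big => [s|s /andP[_ /eqP ->]] //.
by rewrite -(inj_eq enum_val_inj) enum_rankK -andbA [X in _ && X]andbC.
Qed.

Lemma term_cat w w' : g (w ++ w') = g w * g w'.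
Proof.
rewrite /g path_weight_cat path_ratio_cat.
by rewrite !powRM ?(ltW (path_weight_gt0 _ _)) ?(ltW (path_ratio_gt0 _ _))// mulrACA.
Qed.

(** Uniform in [t] and [n]: the supersolution bounds the weighted sum by its first-edge value, and
    its positive minimum removes the weights. *)
Lemma cells_sum_bounded (v0 : V) :
  irreducible_mx (Bmatrix I lw q gamma) ->
  spectral_radius (Bmatrix I lw q gamma) = 1 ->
  exists2 C : R, 0 < C & forall u t n, \sum_(w <- cells I (good lw) t n u) g w <= C.
Proof.
move=> irr rho1; have [h h0 hh] := good_supersolution v0 irr rho1.
have [hm hm0 hmP] := fin_lbound h0.
have g0 w : 0 <= g w by rewrite mulr_ge0 ?powR_ge0.
have [C C0 HC] := fin_ubound (fun u => \sum_(b <- edges_from u) g b * h (path_end u b)).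
exists (C / hm); first by rewrite divr_gt0.
move=> u t n; rewrite ler_pdivlMr// mulr_suml; apply: le_trans (HC u).
apply: (@le_trans _ _ (\sum_(w <- cells I (good lw) t n u) g w * h (path_end u w))).
  by apply: ler_sum => w _; rewrite ler_wpM2l.
rewrite big_allpairs_dep/=; apply: ler_sum => b _.
under eq_bigr do rewrite term_cat path_end_cat -mulrA.
rewrite -mulr_sumr ler_wpM2l//; apply: words_sum_le => //; last exact: term_cat.
by rewrite /g /path_weight /path_ratio !big_nil !powR1 mulr1.
Qed.

End Supersolution.

(** * The packing moment of the overlap *)

Theorem theorem1p2 (R : realType) (m : nat) (G : digraph)
    (I : ifs_prob R m G)
    (F : vertex G -> set 'rV[R]_m) (hF : is_attractor I F)
    (mu : vertex G -> borel_probability R m)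
    (hmu : is_selfsimilar_measure I mu)
    (hosc : osc I)
    (U : vertex G -> set 'rV[R]_m) (hU : sosc_sets I F U)
    (l : nat) (hl : (0 < l)%N)
    (lw : vertex G -> l.-tuple (edge G)) (hlw : admissible_words I lw F U)
    (N : nat)
    (hN : 2 * d_max F / c_min I lw F U <= 1 / r_max I ^ (N%:Z - 1))
    (hdelta : 0 < delta I N l F < 1)
    (u : vertex G) (q gamma : R)
    (hirr : irreducible_mx (Bmatrix I lw q gamma))
    (hgamma : spectral_radius (Bmatrix I lw q gamma) = 1)
    (e f : edge G) (he : ini e = u) (hf : ini f = u) (hef : e <> f) :
  exists C : R, 0 < C /\
    forall r : R, 0 < r < delta I N l F ->
      (Qmoment I F mu u q e f r <= (C * r `^ (- gamma))%:E)%E.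
Proof.
have [hO _] := hU; have [U0 US Udisj] := hO.
have V0 v : F v !=set0 by have [] := hF v.
have [c c0 hc] : exists2 c, 0 < c & forall v x y,
    F (path_end ter v (lw v)) x -> eudist (path_simil I (lw v) x) y < c -> U v y.
  have sep v : exists c, 0 < c /\ forall x y,
      F (path_end ter v (lw v)) x -> eudist (path_simil I (lw v) x) y < c -> U v y.
    have [_ sub] := hlw v; have [_ _ oU] := U0 v.
    have cK : compact (path_simil I (lw v) @` F (path_end ter v (lw v))).
      apply: continuous_compact; last by have [] := hF (path_end ter v (lw v)).
      apply: continuous_subspaceT => x A /nbhs_eudistP[d d0 dA].
      apply/nbhs_eudistP; exists (d / path_ratio I (lw v)).
        by rewrite divr_gt0// path_ratio_gt0.
      move=> y /= xy; apply: dA => /=; rewrite eudist_path_simil.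
      by rewrite mulrC -ltr_pdivlMr// path_ratio_gt0.
    have [c c0 cU] := compact_sub_open cK oU sub.
    by exists c; split => // x y Fx; apply: cU; exists x.
  have [c c0 cle] := @fin_lbound _ _ (fun v => sval (cid (sep v)))
    (fun v => (svalP (cid (sep v))).1).
  exists c => // v x y Fx xy; apply: ((svalP (cid (sep v))).2 x y Fx).
  exact: lt_le_trans xy (cle v).
pose a v := sval (cid (let: And3 U0v _ _ := U0 v in U0v)).
have Ua v : U v (a v) by rewrite /a; case: cid.
have [eps eps0 ha] : exists2 eps, 0 < eps & forall v y, eudist (a v) y < eps -> U v y.
  have sep v : exists d, 0 < d /\ forall y, eudist (a v) y < d -> U v y.
    have [_ _ /open_eudistP/(_ _ (Ua v))[d d0 dU]] := U0 v.
    by exists d; split => // y; exact: dU.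
  have [d d0 dle] := @fin_lbound _ _ (fun v => sval (cid (sep v)))
    (fun v => (svalP (cid (sep v))).1).
  exists d => // v y xy; apply: ((svalP (cid (sep v))).2 y).
  exact: lt_le_trans xy (dle v).
have [D D0 [hDa hD]] : exists2 D, 0 < D &
    (forall v x, F v x -> eudist x (a v) <= D) /\
    (forall v x y, F v x -> F v y -> eudist x y <= D).
  have bd v : exists M, forall x y, F v x -> F v y -> eudist x y <= M.
    by have [_ /compact_ebounded[M ?] _] := hF v; exists M.
  pose x0 v := sval (cid (V0 v)).
  have Fx0 v : F v (x0 v) by rewrite /x0; case: cid.
  have [M M0 MP] := fin_ubound (fun v => sval (cid (bd v))).
  have [M' M'0 M'P] := fin_ubound (fun v => eudist (x0 v) (a v)).
  have HM v x y : F v x -> F v y -> eudist x y <= M.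
    by move=> Fx Fy; apply: le_trans (MP v); case: cid => /= ?; apply.
  exists (M + M'); first by rewrite addr_gt0.
  split => [v x Fx|v x y Fx Fy].
    apply: le_trans (eudist_triangle (x0 v) _ _) _.
    by apply: lerD => //; exact: HM Fx (Fx0 v).
  by rewrite (le_trans (HM _ _ _ Fx Fy))// lerDl ltW.
have [c1 c10 hc1] := fin_lbound (@ratio_gt0 _ _ _ I).
have [c2 /andP[c20 c21] hc2] := ratio_ubound_lt1 I.
have [pmin pmin0 hp] := fin_lbound (@weight_gt0 _ _ _ I).
have kappa0 : 0 < 3 / c by rewrite divr_gt0.
have beta0 : 0 < Num.min c1 (3 / c * c1 ^+ l).
  by rewrite lt_min c10 mulr_gt0// exprn_gt0.
have [C1 C10 HC1] := separated_sum_le hF hmu hO hl c0 hc eps0 ha D0 hDa hD c10 c20 c21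
  pmin0 hc1 hc2 hp q.
have [C2 C20 HC2] := powR_le_scale (- gamma) beta0 kappa0.
have [C3 C30 HC3] := cells_sum_bounded u hirr hgamma.
exists (C1 * C2 * C3); split; first by rewrite !mulr_gt0.
move=> r /andP[r0 rd].
have r01 : 0 < r < 1 by rewrite r0 (lt_trans rd)//; have /andP[] := hdelta.
have [n hn] := fuel_exists c20 c21 (mulr_gt0 kappa0 r0).
(* The first supremum runs over separated sets, the second, from [esum], over their finite
   subsets. *)
apply: ge_ereal_sup => _ [X [XA Xsep] <-].
apply: ge_ereal_sup => _ [Y [finY YX] <-].
have {finY}[s us Ys] : exists2 s, uniq s & Y = [set` s].
  have /finite_seqP[s ->] := finY; exists (undup s); first exact: undup_uniq.
  by apply/seteqP; split => x /=; rewrite mem_undup.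
rewrite Ys -fsbig_seq//=.
have mE x : (mu u (euball x r) `^ q = (ball_mass mu u x r `^ q)%:E)%E.
  by rewrite ball_massE poweR_EFin.
under eq_bigr do rewrite mE.
rewrite sumEFin lee_fin.
have YX' x : x \in s -> X x by move=> sx; apply: YX; rewrite Ys.
apply: le_trans (HC1 u r n _ r01 hn us _ _) _.
- move=> x /YX' /XA [[y Fy xE] xf]; split.
    by rewrite -xE -he; apply: (attractor_sub hF); exists y.
  have [z Fz xz] : exists2 z, F (ter f) z & eudist x (simil I f z) < 2 * r.
    have Sn : [set eudist x y | y in simil I f @` F (ter f)] !=set0.
      have [z Fz] := V0 (ter f).
      by exists (eudist x (simil I f z)), (simil I f z) => //; exists z.
    (* Relaxing [r] to [2 * r] produces a nearby point without attaining the infimum. *)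
    have : dist_pt x (simil I f @` F (ter f)) < 2 * r.
      by apply: le_lt_trans xf _; lra.
    by move=> /(inf_lt Sn)[_ [_ [z Fz <-] <-] lt]; exists z.
  (* The competitor of [e] is [f]; that of any other edge is [e], whose piece contains [x]
     itself. *)
  move=> g gu; have [->|ge] := pselect (g = e).
    by exists f, z; split => // fe; apply: hef.
  exists e, y; split => //; first by move=> /esym.
  by rewrite xE eudistxx mulr_gt0.
- by move=> x y /YX' Xx /YX' Xy /eqP; exact: Xsep.
(* Cell ratios are comparable to [r], so the missing factor [path_ratio I w ^ gamma] costs a
   multiple of [r ^ -gamma], whatever the sign of [gamma]. *)
have wle w : w \in cells I (good lw) (3 / c * r) n u -> path_weight I w `^ q <=
    C2 * r `^ (- gamma) * (path_weight I w `^ q * path_ratio I w `^ gamma).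
  move=> /(cells_ratio hl c0 c10 c20 c21 hc1 hc2 (@size_good _ _ lw) r01 hn) wr.
  have w0 := path_ratio_gt0 I w.
  rewrite mulrCA ler_peMr ?powR_ge0//.
  rewrite -(@mulVf _ (path_ratio I w `^ gamma)) ?gt_eqF ?powR_gt0//.
  by rewrite ler_pM2r ?powR_gt0// -powRN; exact: HC2.
have -> : C1 * C2 * C3 * r `^ (- gamma) = C1 * (C2 * r `^ (- gamma) * C3) by ring.
rewrite ler_pM2l//.
apply: (@le_trans _ _ (C2 * r `^ (- gamma) *
   \sum_(w <- cells I (good lw) (3 / c * r) n u)
     path_weight I w `^ q * path_ratio I w `^ gamma)).
  by rewrite mulr_sumr big_seq [leRHS]big_seq; apply: ler_sum => w; exact: wle.
by rewrite ler_pM2l ?mulr_gt0 ?powR_gt0//; exact: HC3.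
Qed.
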